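(* Let $(\Omega,\eta,X,\mu,Y,\nu,i,j)$ be a measure equivalence coupling between unimodular lcsc groups $G$ and $H$, with action $(g,h,t)\mapsto (g,h).t$. Then there are conull Borel subsets $\Omega'\subset\Omega$, $X'\subset X$, $Y'\subset Y$ and a measure preserving Borel action $G\times H\times\Omega'\to\Omega'$, $(g,h,t)\mapsto(g,h)\triangleright t$, such that: (i) for every $(g,h)\in G\times H$, $(g,h).t=(g,h)\triangleright t$ for $\eta$-almost every $t\in\Omega'$; (ii) there is a Borel isomorphism $i':G\times Y'\to\Omega'$ with $i'_*(\lambda_G\times\nu|_{Y'})=\eta|_{\Omega'}$ and $i'(g_0g,y)=(g_0,e_H)\triangleright i'(g,y)$ for all $g_0,g\in G$, $y\in Y'$; (iii) there is a Borel isomorphism $j':H\times X'\to\Omega'$ with $j'_*(\lambda_H\times\mu|_{X'})=\eta|_{\Omega'}$ and $j'(h_0h,x)=(e_G,h_0)\triangleright j'(h,x)$ for all $h_0,h\in H$, $x\in X'$.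
   Context: lcsc = locally compact second countable Hausdorff; $\lambda_G$ is a Haar measure. For unimodular lcsc $G,H$, a measure equivalence coupling is a tuple $(\Omega,\eta,X,\mu,Y,\nu,i,j)$ where $\Omega$ is a standard Borel space with a Borel action of $G\times H$ preserving a nonzero Borel measure $\eta$, $(X,\mu),(Y,\nu)$ are standard Borel spaces with finite Borel measures, $i$ is an isomorphism of measure $G$-spaces from $(G\times Y,\lambda_G\times\nu)$ (with $g.(g',y)=(gg',y)$) to $(\Omega,\eta)$, and $j$ is an isomorphism of measure $H$-spaces from $(H\times X,\lambda_H\times\mu)$ (with $h.(h',x)=(hh',x)$) to $(\Omega,\eta)$; an isomorphism of measure $G$-spaces is a measurable map restricting, between conull $G$-invariant measurable subsets, to a $G$-equivariant measurable bijection with measurable inverse that pushes one measure onto the other. *)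

(* Defs.v *)
From HB Require Import structures.
From mathcomp Require Import all_boot all_order all_algebra.
From mathcomp Require Import all_classical all_reals all_analysis.
Set Implicit Arguments. Unset Strict Implicit. Unset Printing Implicit Defensive.
Import Order.TTheory GRing.Theory Num.Theory.
Import numFieldNormedType.Exports.
Local Open Scope classical_set_scope.
Local Open Scope ring_scope.

Notation borel G := (g_sigma_algebraType (@open G)).

Definition lcsc_group (G : ptopologicalType) (mul : G -> G -> G) (e : G)
    (inv : G -> G) : Prop :=
  [/\ associative mul, left_id e mul & left_inverse e inv mul] /\
  [/\ continuous (fun p : G * G => mul p.1 p.2), continuous inv,
      hausdorff_space G, locally_compact [set: G] & @second_countable G].

Section Haar.
Local Open Scope ereal_scope.
Variables (R : realType) (G : ptopologicalType) (mul : G -> G -> G).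

Definition haar (lam : set (borel G) -> \bar R) : Prop :=
  [/\ forall (g : G) (A : set (borel G)), measurable A ->
        lam [set x | A (mul g x)] = lam A,
      forall K : set G, compact K -> lam K < +oo,
      forall A : set (borel G), measurable A ->
        lam A = ereal_inf [set lam U | U in [set U : set G | open U /\ A `<=` U]],
      forall U : set G, open U ->
        lam U = ereal_sup [set lam K | K in [set K : set G | compact K /\ K `<=` U]]
    & lam setT != 0].

Definition unimodular : Prop :=
  forall lam : {measure set (borel G) -> \bar R}, haar lam ->
    forall (g : G) (A : set (borel G)), measurable A ->
      lam [set x | A (mul x g)] = lam A.
End Haar.

Definition standard_borel (R : realType) (d : measure_display)
    (X : measurableType d) : Prop :=
  exists dist : X -> X -> R,
    [/\ (forall x y, 0 <= dist x y), (forall x y, dist x y = 0 <-> x = y),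
        (forall x y, dist x y = dist y x)
      & (forall x y z, dist x z <= dist x y + dist y z)] /\
    (forall u : nat -> X,
       (forall eps : R, 0 < eps -> exists N, forall m n, (N <= m)%N -> (N <= n)%N ->
          dist (u m) (u n) < eps) ->
       exists x, forall eps : R, 0 < eps -> exists N, forall n, (N <= n)%N ->
          dist (u n) x < eps) /\
    (exists D : set X, countable D /\
       forall x (eps : R), 0 < eps -> exists2 y, D y & dist x y < eps) /\
    (@measurable d X =
       <<s [set U : set X | forall x, U x ->
              exists2 r : R, 0 < r & [set y | dist x y < r] `<=` U] >>).

Section MeasIso.
Local Open Scope ereal_scope.
Definition meas_space_iso (R : realType) (d1 d2 : measure_display)
    (T1 : measurableType d1) (T2 : measurableType d2) (A : Type)
    (act1 : A -> T1 -> T1) (act2 : A -> T2 -> T2)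
    (m1 : set T1 -> \bar R) (m2 : set T2 -> \bar R) (f : T1 -> T2) : Prop :=
  measurable_fun setT f /\
  exists (S1 : set T1) (S2 : set T2) (finv : T2 -> T1),
    [/\ measurable S1, measurable S2, m1 (~` S1) = 0 & m2 (~` S2) = 0] /\
    [/\ (forall a x, S1 (act1 a x) <-> S1 x) & (forall a y, S2 (act2 a y) <-> S2 y)] /\
    [/\ (forall x, S1 x -> S2 (f x)), (forall y, S2 y -> S1 (finv y)),
        (forall x, S1 x -> finv (f x) = x) & (forall y, S2 y -> f (finv y) = y)] /\
    [/\ measurable_fun S1 f, measurable_fun S2 finv,
        (forall a x, S1 x -> f (act1 a x) = act2 a (f x))
      & (forall B, measurable B -> B `<=` S2 -> m1 (S1 `&` f @^-1` B) = m2 B)].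
End MeasIso.

(* Main.v *)
Require Import Defs.
From HB Require Import structures.
From mathcomp Require Import all_boot all_order all_algebra.
From mathcomp Require Import all_classical all_reals all_analysis.
From mathcomp Require Import lra measurable_realfun.
From mathcomp Require finmap.
Import Order.TTheory GRing.Theory Num.Theory.
Import numFieldNormedType.Exports.
Local Open Scope classical_set_scope.
Local Open Scope ring_scope.
Set Implicit Arguments.
Unset Strict Implicit.
Unset Printing Implicit Defensive.

(** The given action is kept; only the domain and the two isomorphisms change.
    Let [O] be the [G]-invariant conull image of [i]. The set [E] of the points
    [t] such that [h.t] lies in [O] for almost every [h] is Borel, conull by
    Fubini, [G]-invariant, and [H]-invariant because Haar measure on [H] is
    right invariant. Together with the symmetric set for [j] this gives [Om'].

    On [E] the action of [G] still admits a Borel equivariant map [L] to [G]: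
    [h |-> pi (h.t)], with [pi] the [G]-coordinate on [O], is an almost
    everywhere defined function to [G] that [g] translates on the left, and [L t]
    is its limit along a sequence of subsets of [H] on which it concentrates at
    smaller and smaller scales; the sequence is chosen from a fixed countable
    family by left invariant conditions only.

    The points of [E] outside [O] form a null set which must be absorbed into
    [G * Y]. If [nu] is not purely atomic, [Y] contains a null Borel copy of the
    standard Borel space [Om] (a Cantor scheme), which receives the null
    fundamental domain [L = e]. If [nu] is purely atomic, [E] is contained in
    [O]: an orbit of [G] in [E] is a translate of an orbit of positive measure,
    hence meets the conull set [O]. *)

(** * Standard Borel spaces *)

Section MeasurablePredicates.
Context {d : measure_display} {T : measurableType d}.

Lemma measurable_exists (I : countType) (P : I -> T -> Prop) :
  (forall i, measurable [set x | P i x]) -> measurable [set x | exists i, P i x].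
Proof.
move=> mP; rewrite (_ : [set x | _] = \bigcup_i [set x | P i x]).
  by apply: countable_bigcupT_measurable => // i; exact: mP.
by apply/seteqP; split=> x /= => [[i Pi]|[i _ Pi]]; exists i.
Qed.

Lemma measurable_forall (I : countType) (P : I -> T -> Prop) :
  (forall i, measurable [set x | P i x]) -> measurable [set x | forall i, P i x].
Proof.
move=> mP; rewrite (_ : [set x | _] = ~` [set x | exists i, ~ P i x]).
  by apply: measurableC; apply: measurable_exists => i; exact: measurableC (mP i).
apply/seteqP; split=> x /=; first by move=> Px [i]; exact.
by move=> nP i; apply: contrapT => nPi; apply: nP; exists i.
Qed.

Lemma measurable_not (P : T -> Prop) :
  measurable [set x | P x] -> measurable [set x | ~ P x].
Proof. exact: measurableC. Qed.

Lemma measurable_conj (P Q : T -> Prop) : measurable [set x | P x] ->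
  measurable [set x | Q x] -> measurable [set x | P x /\ Q x].
Proof. exact: measurableI. Qed.

Lemma measurable_imply (P Q : T -> Prop) : measurable [set x | P x] ->
  measurable [set x | Q x] -> measurable [set x | P x -> Q x].
Proof.
move=> mP mQ; rewrite (_ : [set x | _] = ~` [set x | P x] `|` [set x | Q x]).
  by apply: measurableU => //; exact: measurableC.
apply/seteqP; split=> x /=; last by case.
by move=> PQ; have [/PQ|] := pselect (P x); [right|left].
Qed.

Lemma measurable_const (P : Prop) : measurable [set x : T | P].
Proof.
have [p|np] := pselect P.
  by rewrite (_ : [set x | _] = setT)//; apply/seteqP; split.
by rewrite (_ : [set x | _] = set0)//; apply/seteqP; split.
Qed.

End MeasurablePredicates.

Lemma measure_le d (T : measurableType d) (R : realType)
    (m : {measure set T -> \bar R}) (A B : set T) :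
  measurable A -> measurable B -> A `<=` B -> (m A <= m B)%E.
Proof. by move=> mA mB AB; apply: le_measure => //; exact: mem_set. Qed.

Section StandardBorelBasis.
Context (R : realType).

Lemma ex_invn_lt (e : R) : 0 < e -> exists n : nat, n.+1%:R^-1 < e.
Proof.
move=> e0; exists (Num.truncn e^-1); rewrite invf_plt ?posrE//.
by rewrite truncnS_gt // num_real.
Qed.

Definition dist_open {X : Type} (dist : X -> X -> R) (U : set X) :=
  forall x, U x -> exists2 r : R, 0 < r & [set y | dist x y < r] `<=` U.

(** A complete metric generating the sigma-algebra, with one enumeration of balls: ball [n] has
    centre [c n] and radius [r n]. Separability survives only as [basis_near], which puts every
    point in basic balls of arbitrarily small radius. *)
Record borel_basis {d} {X : measurableType d} (dist : X -> X -> R)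
    (c : nat -> X) (r : nat -> R) : Prop := BorelBasis {
  dist_ge0 : forall x y, 0 <= dist x y;
  dist_eq0 : forall x y, dist x y = 0 -> x = y;
  distxx : forall x, dist x x = 0;
  dist_sym : forall x y, dist x y = dist y x;
  dist_triangle : forall x y z, dist x z <= dist x y + dist y z;
  dist_complete : forall u : nat -> X,
    (forall eps : R, 0 < eps -> exists N, forall m n, (N <= m)%N -> (N <= n)%N ->
       dist (u m) (u n) < eps) ->
    exists x, forall eps : R, 0 < eps -> exists N, forall n, (N <= n)%N ->
       dist (u n) x < eps;
  measurable_dist : @measurable d X = <<s dist_open dist >>;
  basis_rad_gt0 : forall n, 0 < r n;
  basis_near : forall x e, 0 < e -> exists2 n, dist (c n) x < r n & r n < e }.

Lemma standard_borel_basis {d} {X : measurableType d} : standard_borel R X ->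
  exists dist c r, @borel_basis d X dist c r.
Proof.
move=> [dist [[d0 dE ds dt] [dc [[D [cD Dd] mX]]]]].
have [f fi] := countable_injP _ cD.
(* [q n] is the dense point that [f] numbers [n], or [point] if there is none. The index of a ball
   decodes to such a number and to the [m] that fixes its radius; an index that is no code decodes
   to [(0, 0)] and only repeats a legitimate ball. *)
pose q n := xget point [set x | D x /\ f x = n].
have qf x : D x -> q (f x) = x.
  move=> Dx; rewrite /q; case: xgetP => [y _ [Dy fy]|/(_ x)/=].
    by apply: fi; rewrite ?inE.
  by move=> /(_ (conj Dx erefl)).
pose c n := q (odflt (0, 0)%N (unpickle n)).1.
pose r n : R := (odflt (0, 0)%N (unpickle n)).2.+1%:R^-1.
have dxx x : dist x x = 0 by apply/dE.
exists dist, c, r; split=> //.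
- by move=> x y /dE.
- by move=> n; rewrite /r invr_gt0.
move=> x e e0; have [m me] := ex_invn_lt e0.
have [y Dy xy] := Dd x m.+1%:R^-1 ltac:(by rewrite invr_gt0).
exists (pickle (f y, m)); rewrite /c /r pickleK//=.
by rewrite qf// ds.
Qed.

Context {d} {X : measurableType d} (dist : X -> X -> R).
Context (c : nat -> X) (r : nat -> R) (B : borel_basis dist c r).

Lemma dist_open_measurable (U : set X) : dist_open dist U -> measurable U.
Proof. by move=> oU; rewrite (measurable_dist B); exact: sub_sigma_algebra. Qed.

Lemma measurable_dist_lt x e : measurable [set y | dist x y < e].
Proof.
apply: dist_open_measurable => y /= xy; exists (e - dist x y); first by rewrite subr_gt0.
move=> z /= yz; apply: le_lt_trans (dist_triangle B x y z) _.
by rewrite -ltrBrDl.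
Qed.

Lemma measurable_dist_le x e : measurable [set y | dist x y <= e].
Proof.
rewrite (_ : [set y | _] = ~` [set y | e < dist x y]); last first.
  by apply/seteqP; split=> y /= ; rewrite leNgt => /negP.
apply: measurableC; apply: dist_open_measurable => y /= xy.
exists (dist x y - e); first by rewrite subr_gt0.
move=> z /= yz; have := dist_triangle B x z y; rewrite (dist_sym B z y).
by lra.
Qed.

Lemma measurable_dist1 (x : X) : measurable [set x].
Proof.
rewrite (_ : [set x] = [set y | dist x y <= 0]); first exact: measurable_dist_le.
apply/seteqP; split=> y /=; first by move=> ->; rewrite (distxx B).
move=> xy; apply/esym/(dist_eq0 B)/eqP.
by rewrite eq_le xy (dist_ge0 B).
Qed.

Lemma basis_ball_sub x e : 0 < e ->
  exists2 n, dist (c n) x < r n & [set y | dist (c n) y < r n] `<=` [set y | dist x y < e].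
Proof.
move=> e0; have [n nx ne] := basis_near B x (e := e / 2) ltac:(by rewrite divr_gt0).
exists n => // y /= ny; have := dist_triangle B x (c n) y.
by rewrite (dist_sym B x (c n)); lra.
Qed.

(** Basic balls suffice because every open set is the countable union of the basic balls that it
    contains. *)
Lemma measurable_fun_basis {d'} {T : measurableType d'} (D : set T) (f : T -> X) :
  (forall n, measurable (D `&` [set t | dist (c n) (f t) < r n])) ->
  measurable_fun D f.
Proof.
move=> mf; apply: (measurability (dist_open dist)); first exact: (measurable_dist B).
move=> _ [U oU <-].
rewrite (_ : _ `&` _ = \bigcup_(n in [set n | [set y | dist (c n) y < r n] `<=` U])
   (D `&` [set t | dist (c n) (f t) < r n])).
  by apply: bigcup_measurable => n _; exact: mf.
apply/seteqP; split=> t.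
  move=> [Dt Ut]; have [e e0 eU] := oU _ Ut.
  have [n nt ne] := basis_ball_sub (f t) e0.
  by exists n => //=; apply: subset_trans ne eU.
by move=> [n nU [Dt nt]]; split=> //; exact: nU.
Qed.

End StandardBorelBasis.

(** A point is coded by the set of basic balls that contain it; by completeness
    the codes are cut out by a countable Boolean combination of conditions on
    single coordinates. *)
Lemma standard_borel_code (R : realType) d (X : measurableType d) :
  standard_borel R X ->
  exists (a : X -> nat -> bool) (dec : (nat -> bool) -> X) (Im : set (nat -> bool)),
    [/\ forall n, measurable [set x | a x n], forall x, Im (a x),
        forall x, dec (a x) = x, forall s, Im s -> a (dec s) = s
      & forall d' (T : measurableType d') (D : T -> nat -> bool),
          (forall n, measurable [set t | D t n]) ->
          measurable [set t | Im (D t)] /\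
          measurable_fun [set t | Im (D t)] (fun t => dec (D t))].
Proof.
move=> /standard_borel_basis[dist [c [r B]]].
have dt := dist_triangle B; have ds := dist_sym B.
have d0 := dist_ge0 B; have dxx := distxx B.
have r0 := basis_rad_gt0 B; have near := basis_near B.
pose a x n := dist (c n) x < r n.
have a_inj x y : a x = a y -> x = y.
  move=> xy; apply: (dist_eq0 B); apply/eqP; rewrite eq_le d0 andbT leNgt.
  apply/negP => xy0; have [n nx ne] := near x (dist x y / 2) ltac:(by rewrite divr_gt0).
  have : a y n by rewrite -xy.
  by rewrite /a => ny; have := dt x (c n) y; rewrite (ds x (c n)); lra.
(* In order: the code has arbitrarily small balls; any two of its balls overlap; each of them
   contains another one; any ball containing one of them belongs to it. Overlap and containment are
   read off centres and radii, so they are constants and only the bits of [s] vary. *)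
pose Im : set (nat -> bool) := [set s | (forall m, exists n, s n /\ r n < m.+1%:R^-1) /\
  ((forall n n', s n -> s n' -> dist (c n) (c n') < r n + r n') /\
  ((forall n, s n -> exists n', s n' /\ dist (c n) (c n') + r n' < r n) /\
  (forall n n', s n' -> dist (c n) (c n') + r n' < r n -> s n)))].
pose dec s := xget point [set x | a x = s].
have Ima x : Im (a x).
  split=> [m|]; last split=> [n n'|]; last split=> [n|n n']; rewrite /a.
  - have [n nx nm] := near x m.+1%:R^-1 ltac:(by rewrite invr_gt0).
    by exists n.
  - by move=> ? ?; have := dt (c n) x (c n'); rewrite (ds x (c n')); lra.
  - move=> nx; have [n' n'x n'm] := near x ((r n - dist (c n) x) / 2) ltac:(by lra).
    by exists n'; split=> //; have := dt (c n) x (c n'); rewrite (ds x (c n')); lra.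
  - by move=> n'x n'n; have := dt (c n) (c n') x; lra.
have decE s : (exists x, a x = s) -> a (dec s) = s.
  by move=> /(xgetPex point).
have Im_ex s : Im s -> exists x, a x = s.
  move=> [s1 [s2 [s3 s4]]].
  (* The decoded point is the limit of the centres of ever smaller balls of the code. *)
  pose k m := xget 0%N [set n | s n /\ r n < m.+1%:R^-1].
  have kP m : s (k m) /\ r (k m) < m.+1%:R^-1 := xgetPex 0%N (s1 m).
  have small e : 0 < e -> exists N, forall n, (N <= n)%N -> r (k n) < e.
    move=> e0; have [N Ne] := ex_invn_lt e0; exists N => n Nn.
    apply: lt_trans (kP n).2 _; apply: le_lt_trans Ne.
    by rewrite lef_pV2 ?posrE ?ltr0n// ler_nat.
  have [e|x xP] := dist_complete B (u := c \o k).
    move=> e0; have [N NP] := small (e / 2) ltac:(by lra).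
    exists N => m n Nm Nn /=; have := s2 _ _ (kP m).1 (kP n).1.
    by have := NP _ Nm; have := NP _ Nn; lra.
  (* The limit only gives closed balls; strictness is recovered below from [s3], which supplies a
     ball of the code formally inside the given one. *)
  have le_x n : s n -> dist (c n) x <= r n.
    move=> sn; rewrite leNgt; apply/negP => lt.
    pose e := (dist (c n) x - r n) / 2; have e0 : 0 < e by rewrite /e; lra.
    have [N NP] := small e e0; have [M MP] := xP e e0.
    have := NP _ (leq_maxl N M); have := MP _ (leq_maxr N M).
    set l := maxn N M => /= h1 h2; have := s2 _ _ sn (kP l).1.
    by have := dt (c n) (c (k l)) x; rewrite /e in h1 h2; lra.
  exists x; apply/funext => n; apply/idP/idP; rewrite /a.
    move=> nx; pose e := (r n - dist (c n) x) / 2; have e0 : 0 < e by rewrite /e; lra.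
    have [N NP] := small e e0; have := NP _ (leqnn N) => h.
    apply: (s4 n (k N)); first exact: (kP N).1.
    have := le_x _ (kP N).1; have := dt (c n) x (c (k N)); rewrite (ds x (c _)).
    by rewrite /e in h; lra.
  move=> sn; have [n' [sn' lt]] := s3 _ sn.
  by have := le_x _ sn'; have := dt (c n) (c n') x; lra.
exists a, dec, Im; split => //.
- move=> n; exact: measurable_dist_lt B _ _.
- by move=> x; apply: a_inj; apply: decE; exists x.
- by move=> s /Im_ex; exact: decE.
move=> d' T D mD; have mIm : measurable [set t | Im (D t)].
  apply: measurable_conj.
    apply: measurable_forall => m; apply: measurable_exists => n.
    by apply: measurable_conj => //; exact: measurable_const.
  apply: measurable_conj.
    apply: measurable_forall => m; apply: measurable_forall => n.
    by do 2 apply: measurable_imply => //; exact: measurable_const.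
  apply: measurable_conj.
    apply: measurable_forall => m; apply: measurable_imply => //.
    apply: measurable_exists => n.
    by apply: measurable_conj => //; exact: measurable_const.
  apply: measurable_forall => m; apply: measurable_forall => n.
  by do 2 apply: measurable_imply => //; exact: measurable_const.
split=> //; apply: (measurable_fun_basis B) => n.
rewrite (_ : _ `&` _ = [set t | Im (D t)] `&` [set t | D t n]).
  exact: measurableI.
apply/seteqP; split=> t /= [It]; rewrite -[dist _ _ < _]/(a (dec (D t)) n) decE//;
  exact: Im_ex.
Qed.

(** * Null Cantor sets *)

Section Atoms.
Import finmap.
Context (R : realType) d (Y : measurableType d).
Variable nu : {finite_measure set Y -> \bar R}.
Hypothesis m1 : forall y : Y, measurable [set y].
Local Open Scope ereal_scope.

(** For each [n] only finitely many atoms weigh at least [1/(n+1)]: [M] of them would outweigh the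
    finite total mass as soon as [M/(n+1)] exceeds it. *)
Lemma countable_atoms : countable [set y | nu [set y] != 0].
Proof.
have -> : [set y | nu [set y] != 0] = \bigcup_n [set y | (n.+1%:R^-1)%:E <= nu [set y]].
  apply/seteqP; split=> y /=; last first.
    by move=> [n _ /= ny]; rewrite gt_eqF// (lt_le_trans _ ny)// lte_fin invr_gt0.
  move=> ny0; have : 0 < nu [set y] by rewrite lt0e ny0 measure_ge0.
  rewrite -(fineK (fin_num_measure nu _ (m1 y))) lte_fin => /ex_invn_lt[n ny].
  by exists n => //=; rewrite -(fineK (fin_num_measure nu _ (m1 y))) lee_fin ltW.
apply: bigcup_countable => // n _; apply: finite_set_countable.
apply: contrapT => inf.
have [M MP] : exists M : nat, nu setT < (M%:R * n.+1%:R^-1)%:E.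
  exists (Num.truncn (fine (nu setT) * n.+1%:R)%R).+1.
  rewrite -(fineK (fin_num_measure nu _ measurableT)) lte_fin -ltr_pdivrMr ?invr_gt0// invrK.
  by rewrite truncnS_gt // num_real.
have [F FA FM] := infinite_set_fset M inf.
suff : (M%:R * n.+1%:R^-1)%:E <= nu setT by rewrite leNgt MP.
apply: (@le_trans _ _ (nu (\bigcup_(y in [set` F]) [set y]))); last first.
  by apply: measure_le => //; apply: fin_bigcup_measurable => // y _; exact: m1.
rewrite measure_fin_bigcup//; last by apply/trivIsetP => i j _ _ ij; apply/seteqP; split=> z //= [-> /eqP]; rewrite (negbTE ij).
rewrite fsbig_finite// set_fsetK.
apply: (@le_trans _ _ (\sum_(i <- F) (n.+1%:R^-1)%:E)).
  rewrite sumEFin lee_fin big_const_seq count_predT iter_addr_0 mulr_natl.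
  by rewrite ler_wpMn2l ?invr_ge0.
by rewrite big_seq [leRHS]big_seq; apply: lee_sum => i iF; apply: FA.
Qed.

End Atoms.

(** The latest bit comes first, so that lengthening a prefix is a [cons], as in the recursion that
    builds the cells of the Cantor scheme. *)
Fixpoint prefix_rev (f : nat -> bool) n : seq bool :=
  if n is m.+1 then f m :: prefix_rev f m else [::].

Lemma size_prefix_rev f n : size (prefix_rev f n) = n.
Proof. by elim: n => //= n ->. Qed.

Lemma measurable_prefix_rev d (T : measurableType d) (a : T -> nat -> bool) s :
  (forall n, measurable [set t | a t n]) ->
  measurable [set t | prefix_rev (a t) (size s) = s].
Proof.
move=> ma; elim: s => [|b s IHs] /=; first exact: measurable_const.
rewrite (_ : [set t | _] = [set t | a t (size s) = b] `&` [set t | prefix_rev (a t) (size s) = s]).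
  apply: measurableI => //; case: b; first exact: ma.
  rewrite (_ : [set t | _] = ~` [set t | a t (size s)]); first exact: measurableC.
  by apply/seteqP; split=> t /=; [move=> -> ?|move/negP/negbTE].
by apply/seteqP; split=> t /=; [move=> [-> ->] | move=> [-> ->]].
Qed.

Section CantorScheme.
Context (R : realType) d (Y : measurableType d) (dist : Y -> Y -> R).
Context (c : nat -> Y) (r : nat -> R) (B : borel_basis dist c r).
Variable nu : {finite_measure set Y -> \bar R}.

Let At := [set y | nu [set y] != 0%E].

Let mAt : measurable At.
Proof.
apply: countable_measurable; last exact: countable_atoms (measurable_dist1 B).
exact: measurable_dist1 B.
Qed.


(** Closed sets charged by the non-atomic part of [nu]: such a set can always be split in two, and
    closedness keeps limits inside. *)
Definition fat_closed (K : set Y) := dist_open dist (~` K) /\ nu (K `\` At) != 0%E.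

Lemma fat_closed_measurable K : fat_closed K -> measurable K.
Proof. by move=> [/(dist_open_measurable B)/measurableC]; rewrite setCK. Qed.

Lemma fat_closed_nonempty K : fat_closed K -> K !=set0.
Proof.
move=> [_]; apply: contraNP => /set0P/negP; rewrite negbK => /eqP ->.
by rewrite set0D measure0.
Qed.

Lemma dist_openU (U V : set Y) : dist_open dist U -> dist_open dist V ->
  dist_open dist (U `|` V).
Proof.
move=> oU oV x [/oU|/oV] [e e0 eU]; exists e => // y /eU; [by left|by right].
Qed.

Lemma closed_ball_compl_open x e : dist_open dist (~` [set y | dist x y <= e]).
Proof.
move=> y /= /negP; rewrite -ltNge => xy; exists (dist x y - e); first by rewrite subr_gt0.
move=> z /= yz; apply/negP; rewrite -ltNge.
have := dist_triangle B x z y; rewrite (dist_sym B z y).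
by lra.
Qed.

(** Continuity from above: the closed balls of radius [1/(n+1)] shrink to a point that is not an
    atom. *)
Lemma small_closed_ball x e : ~ At x -> 0 < e ->
  exists2 t, 0 < t & forall u, u <= t -> (nu [set y | (dist x y <= u)%R] < e%:E)%E.
Proof.
move=> /negP; rewrite negbK => /eqP x0 e0.
pose F n := [set y | dist x y <= n.+1%:R^-1].
have capF : \bigcap_n F n = [set x].
  apply/seteqP; split=> y /=; last first.
    by move=> -> n _; rewrite /F/= (distxx B) invr_ge0.
  move=> Fy; apply/esym/(dist_eq0 B)/eqP; rewrite eq_le (dist_ge0 B) andbT leNgt.
  by apply/negP => /ex_invn_lt[n]; rewrite ltNge (Fy n I).
have mF n : measurable (F n) by exact: measurable_dist_le B _ _.
have : nu \o F @ \oo --> nu (\bigcap_n F n).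
  apply: nonincreasing_cvg_mu => //.
  - by rewrite -ge0_fin_numE// fin_num_measure.
  - by rewrite capF; exact: measurable_dist1 B _.
  - move=> m n mn; apply/subsetPset => y /=; rewrite /F/= => /le_trans; apply.
    by rewrite lef_pV2 ?posrE ?ltr0n// ler_nat.
rewrite capF x0 => /(_ [set z | z < e%:E]%E)/=; case.
  by apply: open_nbhs_nbhs; split; [exact: open_ereal_lt_ereal|rewrite /= lte_fin].
move=> n _ /(_ n (leqnn n))/= nF; exists n.+1%:R^-1; first by rewrite invr_gt0.
move=> u un; apply: le_lt_trans nF; apply: measure_le => //.
  exact: measurable_dist_le B _ _.
by move=> y /= /le_trans; apply.
Qed.

(** The non-atomic part of [nu] on [K] has at least two points in its support; small closed balls
    around them, cut with [K], are the two pieces. *)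
Lemma fat_closed_split K e : fat_closed K -> 0 < e ->
  exists F : bool -> set Y, F true `&` F false = set0 /\
    forall b, [/\ fat_closed (F b), F b `<=` K, (nu (F b) <= e%:E)%E
                & forall x y, F b x -> F b y -> dist x y < e].
Proof.
move=> fK e0; have mK := fat_closed_measurable fK; case: fK => cK nK.
pose b n := [set y | dist (c n) y < r n].
have mb n : measurable (b n) by exact: measurable_dist_lt B _ _.
(* The union [N] of the basic balls that carry no non-atomic mass of [K] is null, and every non-atom
   of [K] outside it is in the support. *)
pose bad := [set n | nu (K `&` b n `\` At) = 0%E].
pose N := \bigcup_(n in bad) (K `&` b n `\` At).
have N0 : nu N = 0%E.
  apply/eqP; rewrite eq_le measure_ge0 andbT /N bigcup_mkcond.
  apply: (@le_trans _ _ (\sum_(0 <= n <oo) nu (if n \in bad then K `&` b n `\` At else set0))%E).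
    have mm n : measurable (if n \in bad then K `&` b n `\` At else set0).
      by case: ifP => // _; apply: measurableD => //; exact: measurableI.
    by apply: generalized_Boole_inequality => //; exact: bigcup_measurable.
  rewrite eseries0// => n _ _; case: ifPn => [|_]; last exact: measure0.
  by move/set_mem.
have mN : measurable N.
  by apply: bigcup_measurable => n _; apply: measurableD => //; exact: measurableI.
have mKA : measurable (K `\` At) by exact: measurableD.
have big Z : measurable Z -> nu Z = 0%E -> exists x, [/\ K x, ~ At x, ~ N x & ~ Z x].
  move=> mZ Z0; apply: contrapT => /forallNP nex.
  move/eqP: nK; apply; apply: (@subset_measure0 _ _ _ _ _ (N `|` Z)) => //.
  - exact: measurableU.
  - move=> x [Kx Ax]; have := nex x; apply: contraPP => NZ [].
    by split=> // h; apply: NZ; [left|right].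
  - exact: null_set_setU.
have [x [Kx Ax Nx _]] := big set0 measurable0 (measure0 nu).
(* The singleton of [x] may be avoided as a further null set, since [x] is not an atom. *)
have [y [Ky Ay Ny /= xy]] := big [set x] (measurable_dist1 B x)
  ltac:(by move/negP: Ax; rewrite negbK => /eqP).
have fat z u : K z -> ~ At z -> ~ N z -> 0 < u -> fat_closed (K `&` [set w | dist z w <= u]).
  move=> Kz Az Nz u0; split.
    by rewrite setCI; apply: dist_openU => //; exact: closed_ball_compl_open.
  apply/negP => /eqP z0; have [n nz nu_] := basis_ball_sub B z u0.
  apply: Nz; exists n => //=; apply: subset_measure0 z0 => //.
  - by apply: measurableD => //; exact: measurableI.
  - apply: measurableD => //; apply: measurableI => //; exact: measurable_dist_le B _ _.
  - by move=> w [[Kw bw] Aw]; split=> //; split=> //; apply/ltW/nu_.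
have xy0 : 0 < dist x y.
  rewrite lt0r (dist_ge0 B) andbT; apply/eqP => /(dist_eq0 B) e1.
  by apply: xy.
have [t1 t10 t1P] := small_closed_ball Ax e0; have [t2 t20 t2P] := small_closed_ball Ay e0.
(* [t1] and [t2] bound the masses, a third of the distance makes the balls disjoint, and [e / 3]
   keeps their diameters below [e]. *)
pose u := Num.min (Num.min t1 t2) (Num.min (dist x y / 3) (e / 3)).
have u0 : 0 < u by rewrite !lt_min t10 t20 !divr_gt0.
have [ut1 ut2 ux ue] : [/\ u <= t1, u <= t2, u <= dist x y / 3 & u <= e / 3].
  by rewrite /u !ge_min !lexx !orbT.
have main z : K z -> ~ At z -> ~ N z -> (nu [set w | (dist z w <= u)%R] < e%:E)%E ->
  [/\ fat_closed (K `&` [set w | dist z w <= u]), K `&` [set w | dist z w <= u] `<=` K,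
      (nu (K `&` [set w | (dist z w <= u)%R]) <= e%:E)%E
    & forall v w, (K `&` [set w | dist z w <= u]) v -> (K `&` [set w | dist z w <= u]) w -> dist v w < e].
  move=> Kz Az Nz nz; split => //; first exact: fat.
  - apply: le_trans (ltW nz); apply: measure_le => //.
      apply: measurableI => //; exact: measurable_dist_le B _ _.
    exact: measurable_dist_le B _ _.
  - move=> v w [_ /= zv] [_ /= zw]; have := dist_triangle B v z w.
    by rewrite (dist_sym B v z); lra.
exists (fun b => K `&` [set w | dist (if b then x else y) w <= u]); split.
  apply/seteqP; split=> w //= [[_ /= xw] [_ /= yw]].
  by have := dist_triangle B x w y; rewrite (dist_sym B w y); lra.
by case; apply: main => //; [exact: t1P|exact: t2P].
Qed.

(** A union bound over the [2 ^ n] words of length [n], by induction on the first letter. *)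
Lemma measure_prefix_union (M : seq bool -> set Y) n (e : R) : 0 <= e ->
  (forall s, measurable (M s)) ->
  (forall s, size s = n -> (nu (M s) <= e%:E)%E) ->
  (nu [set y | exists s, size s = n /\ M s y] <= (2 ^+ n * e)%:E)%E.
Proof.
move=> e0; elim: n M => [|n IHn] M mM Me.
  rewrite expr0 mul1r (_ : [set y | _] = M [::]); first exact: Me.
  by apply/seteqP; split=> y /= => [[s [/size0nil ->]]|]; last by exists [::].
have mU b : measurable [set y | exists s, size s = n /\ M (b :: s) y].
  apply: measurable_exists => s; apply: measurable_conj; [exact: measurable_const|exact: mM].
rewrite (_ : [set y | _] = [set y | exists s, size s = n /\ M (true :: s) y] `|`
   [set y | exists s, size s = n /\ M (false :: s) y]).
  apply: le_trans (measureU2 _ _ _) _ => //.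
  rewrite exprS -mulrA mulrDl mul1r EFinD; apply: leeD; apply: IHn => //.
    by move=> s sn; apply: Me => /=; rewrite sn.
  by move=> s sn; apply: Me => /=; rewrite sn.
apply/seteqP; split=> y /=.
  by case=> -[[]//|b s [[sn] My]]; case: b My => My; [left|right]; exists s.
by case=> -[s [sn My]]; [exists (true :: s)|exists (false :: s)]; rewrite /= sn.
Qed.

(** A Cantor scheme of fat closed cells [K s] with [s] a finite word. [kap] sends a bit sequence to
    the only point in all its cells, [D] reads the bits back, and [C] is the resulting Cantor set.
    It is null because the masses of the cells decrease faster than their number grows. *)
Lemma cantor_embedding : nu (~` At) != 0%E ->
  exists (kap : (nat -> bool) -> Y) (D : Y -> nat -> bool) (C : set Y),
    [/\ measurable C, nu C = 0%E, forall n, measurable [set y | D y n]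
      & forall f, C (kap f) /\ D (kap f) = f] /\
    [/\ forall y, C y -> kap (D y) = y
      & forall d' (T : measurableType d') (a : T -> nat -> bool),
          (forall n, measurable [set t | a t n]) -> measurable_fun setT (kap \o a)].
Proof.
move=> nuA.
(* The splitting is made total, with its guarantees conditional, so that the cells can be defined by
   plain recursion. *)
have : forall Ke : set Y * R, exists F : bool -> set Y, fat_closed Ke.1 -> 0 < Ke.2 ->
   F true `&` F false = set0 /\
    forall b, [/\ fat_closed (F b), F b `<=` Ke.1, (nu (F b) <= Ke.2%:E)%E
                & forall x y, F b x -> F b y -> dist x y < Ke.2].
  move=> [K e] /=; have [fK|] := pselect (fat_closed K); last by exists (fun=> set0).
  have [e0|] := pselect (0 < e); last by exists (fun=> set0).
  by have [F FP] := fat_closed_split fK e0; exists F.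
move=> /choice[S SP].
(* The ratio [1/4] beats the doubling of the number of cells: level [n] has total mass at most
   [2 ^ -n]. *)
pose eps n : R := 4^-1 ^+ n; have eps0 n : 0 < eps n by rewrite exprn_gt0// invr_gt0.
pose K := fix K s := if s is b :: s' then S (K s', eps (size s)) b else setT.
have fK s : fat_closed (K s).
  elim: s => [|b s IHs]; first by split; [rewrite setCT => ?|rewrite setTD].
  by have [_ /(_ b)[]] := SP (K s, eps (size s).+1) IHs (eps0 _).
have mK s : measurable (K s) by exact: fat_closed_measurable.
have Ksub b s : K (b :: s) `<=` K s.
  by have [_ /(_ b)[]] := SP (K s, eps (size s).+1) (fK s) (eps0 _).
have Kmu b s : (nu (K (b :: s)) <= (eps (size s).+1)%:E)%E.
  by have [_ /(_ b)[]] := SP (K s, eps (size s).+1) (fK s) (eps0 _).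
have Kdiam b s x y : K (b :: s) x -> K (b :: s) y -> dist x y < eps (size s).+1.
  by have [_ /(_ b)[_ _ _]] := SP (K s, eps (size s).+1) (fK s) (eps0 _); exact.
have Kdisj s x : ~ (K (true :: s) x /\ K (false :: s) x).
  have [/seteqP[+ _] _] := SP (K s, eps (size s).+1) (fK s) (eps0 _).
  by move=> /(_ x) h [? ?]; apply: h.
have Kuniq s s' x : size s = size s' -> K s x -> K s' x -> s = s'.
  elim: s s' => [|b s IHs] [|b' s']//= [ss] Kx Kx'.
  have e1 : s = s' by apply: IHs => //; [exact: Ksub Kx|exact: Ksub Kx'].
  subst s'; congr (_ :: _).
  by case: b b' Kx Kx' => -[]// Kx Kx'; exfalso; apply: (Kdisj s x).
have exp_small (q e : R) : 0 < q < 1 -> 0 < e ->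
    exists N, forall n, (N <= n)%N -> q ^+ n < e.
  move=> /andP[q0 q1] e0; have : GRing.exp q @ \oo --> (0 : R).
    by apply: cvg_expr; rewrite gtr0_norm.
  move=> /cvgrPdist_lt/(_ e e0)[N _ NP]; exists N => n Nn.
  by have := NP n Nn; rewrite sub0r normrN gtr0_norm ?exprn_gt0.
have eps_small e : 0 < e -> exists N, forall n, (N <= n)%N -> eps n < e.
  by apply: exp_small; rewrite invr_gt0 ltr0n invf_lt1// ltr1n.
have Kpre f m n : (m <= n)%N -> K (prefix_rev f n) `<=` K (prefix_rev f m).
  elim: n => [|n IHn]; first by rewrite leqn0 => /eqP ->.
  rewrite leq_eqVlt => /orP[/eqP -> //|mn].
  by apply: subset_trans (IHn mn); exact: Ksub.
have Kdiam' f n x y : (0 < n)%N -> K (prefix_rev f n) x -> K (prefix_rev f n) y -> dist x y < eps n.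
  by case: n => // n _ Kx Ky; have := Kdiam _ _ _ _ Kx Ky; rewrite size_prefix_rev.
have kap_ex f : exists y, forall n, K (prefix_rev f n) y.
  pose v n := xget point (K (prefix_rev f n)).
  have vP n : K (prefix_rev f n) (v n).
    by apply: xgetPex; have [y] := fat_closed_nonempty (fK (prefix_rev f n)); exists y.
  have [e|y yP] := dist_complete B (u := v).
    move=> /eps_small[N NP]; exists N.+1 => m n Nm Nn.
    apply: lt_trans (NP N.+1 (leqnSn _)).
    by apply: (Kdiam' f) => //; [apply: Kpre Nm _ (vP m)|apply: Kpre Nn _ (vP n)].
  (* Were the limit outside a cell, so would be a whole ball around it, against the convergence of
     the points [v], which eventually stay in that cell. *)
  exists y => n; apply: contrapT => nK.
  have [e e0 eK] := (fK (prefix_rev f n)).1 y nK.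
  have [M MP] := yP e e0; have := MP _ (leq_maxr n M).
  rewrite (dist_sym B) => /eK/=; apply.
  exact: Kpre (leq_maxl n M) _ (vP _).
pose kap f := xget point [set y | forall n, K (prefix_rev f n) y].
have kapP f n : K (prefix_rev f n) (kap f) by have := xgetPex point (kap_ex f); exact.
have kap_uniq f y : (forall n, K (prefix_rev f n) y) -> kap f = y.
  move=> yP; apply: (dist_eq0 B); apply/eqP; rewrite eq_le (dist_ge0 B) andbT leNgt.
  apply/negP => /eps_small[N /(_ N.+1 (leqnSn _))]; rewrite ltNge.
  by rewrite (ltW (Kdiam' f _ _ _ _ _ _)).
pose D y n := `[< exists s, size s = n /\ K (true :: s) y >].
pose C := [set y | forall n, exists s, size s = n /\ K s y].
have mex (M : seq bool -> set Y) n : (forall s, measurable (M s)) ->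
    measurable [set y | exists s, size s = n /\ M s y].
  move=> mM; apply: measurable_exists => s; apply: measurable_conj; [exact: measurable_const|exact: mM].
have mC : measurable C by apply: measurable_forall => n; exact: mex.
(* The cell of level [n + 1] that holds [y] extends the one of level [n], by disjointness of the
   cells of a level, and [D y n] is its new letter. *)
have DP y n : C y -> K (prefix_rev (D y) n) y.
  move=> Cy; elim: n => //= n IHn.
  have [[|b s] [sn Kbs]] := Cy n.+1; first by [].
  move: sn => [sn].
  have e1 : s = prefix_rev (D y) n.
    by apply: (Kuniq _ _ y) => //; [rewrite size_prefix_rev|exact: Ksub Kbs].
  suff -> : D y n = b by rewrite -e1.
  case: b Kbs => Kbs; first by apply/asboolP; exists s.
  apply/asboolP => -[s' [s'n Ks']].
  have : true :: s' = false :: s by apply: (Kuniq _ _ y) => //=; rewrite s'n sn.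
  by [].
exists kap, D, C; split; split.
- exact: mC.
- apply/eqP; rewrite eq_le measure_ge0 andbT; apply/lee_addgt0Pr => e e0; rewrite add0e.
  have [N NP] : exists N, forall n, (N <= n)%N -> (2^-1 : R) ^+ n < e.
    by apply: exp_small => //; rewrite invr_gt0 ltr0n invf_lt1// ltr1n.
  apply: (@le_trans _ _ (nu [set y | exists s, size s = N.+1 /\ K s y])).
    by apply: measure_le => //; [exact: mex|move=> y /(_ N.+1)].
  apply: le_trans (measure_prefix_union (ltW (eps0 N.+1)) mK _) _.
    by case=> [|b s [<-]] //; exact: Kmu.
  rewrite lee_fin; apply: le_trans (ltW (NP N.+1 (leqnSn N))).
  by rewrite /eps -exprMn (_ : 2 * 4^-1 = 2^-1 :> R)//; lra.
- move=> n; rewrite (_ : [set y | _] = [set y | exists s, size s = n /\ K (true :: s) y]).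
    by apply: (mex (fun s => K (true :: s))).
  by apply/seteqP; split=> y /= /asboolP.
- move=> f; split=> [n|].
    by exists (prefix_rev f n); rewrite size_prefix_rev; split.
  apply/funext => n; apply/idP/idP => [/asboolP[s [sn Ks]]|fn].
    have : true :: s = f n :: prefix_rev f n.
      by apply: (Kuniq _ _ (kap f)) => /=; [rewrite sn size_prefix_rev| |exact: (kapP f n.+1)].
    by case=> <-.
  apply/asboolP; exists (prefix_rev f n); split; first exact: size_prefix_rev.
  by have := kapP f n.+1; rewrite /= fn.
- by move=> y Cy; apply: kap_uniq => n; exact: DP.
move=> d' T a ma; apply: (measurable_fun_basis B) => n; rewrite setTI.
(* Since the cells shrink, [kap (a t)] lies in an open ball exactly when one of its cells does, and
   this depends on finitely many bits. *)
rewrite (_ : [set t | _] = [set t | exists s, K s `<=` [set y | dist (c n) y < r n] /\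
   prefix_rev (a t) (size s) = s]).
  apply: measurable_exists => s; apply: measurable_conj; first exact: measurable_const.
  exact: measurable_prefix_rev.
apply/seteqP; split=> t /=.
  move=> nt; have [N NP] := eps_small (r n - dist (c n) (kap (a t))) ltac:(by rewrite subr_gt0).
  exists (prefix_rev (a t) N.+1); split; last by rewrite size_prefix_rev.
  move=> y Ky /=; have := Kdiam' (a t) N.+1 _ _ isT (kapP _ _) Ky.
  have := NP N.+1 (leqnSn N); have := dist_triangle B (c n) (kap (a t)) y.
  by lra.
by move=> [s [Ks st]]; apply: Ks; rewrite -st; exact: kapP.
Qed.

End CantorScheme.

(** Points of [X] are coded by bit sequences and these are sent into the null Cantor set. [S]
    consists of the points of that set whose bits form a valid code; off [S] the inverse is patched
    by [point]. *)
Lemma standard_borel_null_embedding (R : realType) dX dY (X : measurableType dX)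
    (Y : measurableType dY) (nu : {finite_measure set Y -> \bar R}) :
  standard_borel R X -> standard_borel R Y ->
  nu (~` [set y | nu [set y] != 0%E]) != 0%E ->
  exists (theta : X -> Y) (thetai : Y -> X) (S : set Y),
    [/\ measurable S, nu S = 0%E, measurable_fun setT theta & measurable_fun setT thetai] /\
    [/\ forall x, S (theta x), forall x, thetai (theta x) = x
      & forall y, S y -> theta (thetai y) = y].
Proof.
move=> /standard_borel_code[a [dec [Im [ma Ima deca aI mD]]]].
move=> /standard_borel_basis[dist [c [r B]]] /(cantor_embedding B).
move=> [kap [D [C [[mC C0 mDn kapP] [kD mkap]]]]].
have [mI mdec] := mD _ _ D mDn.
pose S := C `&` [set y | Im (D y)].
have mS : measurable S by exact: measurableI.
have SE y : S y -> ((dec \o D) \_ S) y = dec (D y) by move=> Sy; rewrite patchT//; exact: mem_set.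
have Sk x : S (kap (a x)) by split=> /=; [exact: (kapP _).1|rewrite (kapP _).2].
exists (kap \o a), ((dec \o D) \_ S), S; split; split=> //.
- by apply: subset_measure0 C0 => // y [].
- exact: mkap.
- by apply/(measurable_restrictT _ mS); apply: measurable_funS mdec => // y [].
- by move=> x /=; rewrite SE// (kapP _).2.
- by move=> y Sy /=; rewrite SE//; case: Sy => Cy Iy; rewrite aI// kD.
Qed.

(** * Locally compact groups *)

Lemma second_countable_enum (T : ptopologicalType) : @second_countable T ->
  exists b : nat -> set T, (forall n, open (b n)) /\
    forall (U : set T) x, open U -> U x -> exists n, b n x /\ b n `<=` U.
Proof.
move=> [B cB [Bo Bb]]; have [f fi] := countable_injP _ cB.
pose b n := xget set0 [set A | B A /\ f A = n].
have bf A : B A -> b (f A) = A.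
  move=> BA; rewrite /b; case: xgetP => [A' _ [BA' fA']|/(_ A)/=].
    by apply: fi; rewrite ?inE.
  by move=> /(_ (conj BA erefl)).
exists b; split=> [n|U x oU Ux].
  by rewrite /b; case: xgetP => [A _ [/Bo]|_] //; exact: open0.
have [A [BA Ax] AU] := Bb x U (open_nbhs_nbhs (conj oU Ux)).
by exists (f A); rewrite bf.
Qed.

Lemma borel_open (T : ptopologicalType) (U : set T) : open U ->
  measurable (U : set (borel T)).
Proof. by move=> oU; exact: sub_sigma_algebra. Qed.

Lemma measurable_fun_borel d (X : measurableType d) (T : ptopologicalType)
    (D : set X) (f : X -> borel T) :
  (forall U : set T, open U -> measurable (D `&` f @^-1` U)) -> measurable_fun D f.
Proof.
move=> mf; apply: (@measurability _ _ _ (borel T) D f (@open T)); first by [].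
by move=> _ [U oU <-]; exact: mf.
Qed.

(** The source carries the product of the Borel sigma-algebras; second countability makes every open
    set of the product a countable union of open rectangles, hence measurable there. *)
Lemma continuous2_measurable (S T : ptopologicalType) (f : T * T -> S) :
  @second_countable T -> continuous f ->
  measurable_fun setT (f : borel T * borel T -> borel S).
Proof.
move=> /second_countable_enum[b [bo bb]] cf.
apply: measurable_fun_borel => U oU; rewrite setTI.
rewrite (_ : _ @^-1` _ = [set z : borel T * borel T | exists mn : nat * nat,
   (b mn.1 `*` b mn.2 `<=` f @^-1` U) /\ (b mn.1 z.1 /\ b mn.2 z.2)]).
  apply: measurable_exists => mn; apply: measurable_conj; first exact: measurable_const.
  by apply: (measurableX (A := (b mn.1 : set (borel T))) (B := (b mn.2 : set (borel T))));
    exact: borel_open.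
apply/seteqP; split=> -[x y] /=; last by move=> [[m n] /= [sub xy]]; exact: (sub (x, y)).
move=> Uxy; have := cf (x, y) U (open_nbhs_nbhs (conj oU Uxy)).
move=> [[P Q] /= [nP nQ] PQ].
move: nP nQ; rewrite !nbhsE => -[P' [oP' P'x] P'P] [Q' [oQ' Q'y] Q'Q].
have [m [mx mP]] := bb _ _ oP' P'x; have [n [ny nQ]] := bb _ _ oQ' Q'y.
exists (m, n); split=> // -[x' y'] /= [mx' ny']; apply: (PQ (x', y')) => /=.
by split=> /=; [apply/P'P/mP|apply/Q'Q/nQ].
Qed.

Section LcscGroup.
Context (G : ptopologicalType) (mul : G -> G -> G) (e : G) (inv : G -> G).
Hypothesis hG : lcsc_group mul e inv.

Local Notation "x * y" := (mul x y).

Lemma lg_mulA : associative mul. Proof. by case: hG => -[]. Qed.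
Lemma lg_mul1 x : e * x = x. Proof. by case: hG => -[]. Qed.
Lemma lg_mulV x : inv x * x = e. Proof. by case: hG => -[]. Qed.

Lemma lg_mulVr x : x * inv x = e.
Proof.
rewrite -[LHS]lg_mul1 -{1}(lg_mulV (inv x)) -!lg_mulA (lg_mulA (inv x) x) lg_mulV.
by rewrite lg_mul1 lg_mulV.
Qed.

Lemma lg_mul1r x : x * e = x.
Proof. by rewrite -(lg_mulV x) lg_mulA lg_mulVr lg_mul1. Qed.

Lemma lg_mulKV x y : x * (inv x * y) = y.
Proof. by rewrite lg_mulA lg_mulVr lg_mul1. Qed.

Lemma lg_mulK x y : inv x * (x * y) = y.
Proof. by rewrite lg_mulA lg_mulV lg_mul1. Qed.

Lemma lg_mul_inj x y z : x * y = x * z -> y = z.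
Proof. by move=> /(congr1 (mul (inv x))); rewrite !lg_mulK. Qed.

Lemma lg_invK x : inv (inv x) = x.
Proof. by apply: (@lg_mul_inj (inv x)); rewrite lg_mulVr lg_mulV. Qed.

Lemma lg_invM x y : inv (x * y) = inv y * inv x.
Proof.
by apply: (@lg_mul_inj (x * y)); rewrite lg_mulVr -lg_mulA lg_mulKV lg_mulVr.
Qed.

Lemma lg_inv1 : inv e = e.
Proof. by rewrite -[LHS]lg_mul1r lg_mulV. Qed.

Lemma lg_open_mul (U : set G) a b : open U -> U (a * b) ->
  exists A B : set G, [/\ open A, A a, open B & B b] /\ forall x y, A x -> B y -> U (x * y).
Proof.
case: hG => _ [cm _ _ _ _] oU Uab.
have [[P Q] /= [nP nQ] PQ] := cm (a, b) U (open_nbhs_nbhs (conj oU Uab)).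
move: nP nQ; rewrite !nbhsE => -[P' [oP' P'x] P'P] [Q' [oQ' Q'y] Q'Q].
exists P', Q'; split=> // x y P'x' Q'y'; apply: (PQ (x, y)) => /=.
by split=> /=; [exact/P'P|exact/Q'Q].
Qed.

Lemma lg_open_translate (U : set G) g : open U -> open [set x | U (g * x)].
Proof.
move=> oU; rewrite openE => x /= Ux; have [A [B [[_ Ag oB Bx] AB]]] := lg_open_mul oU Ux.
by rewrite /interior nbhsE; exists B => // y By; exact: AB.
Qed.

Lemma lg_open_inv (U : set G) : open U -> open [set x | U (inv x)].
Proof. by case: hG => _ [_ /continuousP ci _ _ _]; exact: ci. Qed.

Lemma lg_measurable_divl : measurable_fun setT
  (fun z : borel G * borel G => (inv z.1 * z.2 : borel G)).
Proof.
case: hG => _ [cm ci _ _ sc].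
apply: (@continuous2_measurable _ _ (fun z : G * G => inv z.1 * z.2)) => //.
move=> z; apply: (@continuous2_cvg _ _ _ _ (nbhs z) _ (inv \o fst) snd mul).
- exact: (cm (inv z.1, z.2)).
- apply: continuous_comp; [exact: cvg_fst|exact: ci].
- exact: cvg_snd.
Qed.

(** Continuity of the product at the identity is used twice, then the result is cut with its
    inverse. Four factors leave room for comparisons through intermediate points. *)
Lemma lg_small (U : set G) : open U -> U e ->
  exists V : set G, [/\ open V, V e, forall x, V x -> V (inv x)
    & forall a b c d, V a -> V b -> V c -> V d -> U (a * b * (c * d))].
Proof.
have sq W : open W -> W e -> exists V : set G, [/\ open V, V e & forall a b, V a -> V b -> W (a * b)].
  move=> oW We; have [|A [B [[oA Ae oB Be] AB]]] := @lg_open_mul W e e oW.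
    by rewrite lg_mul1.
  by exists (A `&` B); split=> //; [exact: openI|move=> a b [Aa _] [_ Bb]; exact: AB].
move=> oU Ue; have [W [oW We WU]] := sq U oU Ue; have [V [oV Ve VW]] := sq W oW We.
exists (V `&` [set x | V (inv x)]); split.
- by apply: openI => //; exact: lg_open_inv.
- by split=> //=; rewrite lg_inv1.
- by move=> x [Vx Vix]; split=> //=; rewrite lg_invK.
- by move=> a b c d [Va _] [Vb _] [Vc _] [Vd _]; apply: WU; apply: VW.
Qed.

(** The sequence does the work of a left invariant metric: [V k] is the ball of scale [k], and the
    fourfold product replaces the triangle inequality. *)
Lemma lg_nbhs_base : exists V : nat -> set G,
  [/\ forall k, open (V k), forall k, V k e & forall k x, V k x -> V k (inv x)] /\
  [/\ forall k a b c d, V k.+1 a -> V k.+1 b -> V k.+1 c -> V k.+1 d -> V k (a * b * (c * d)),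
      forall U : set G, open U -> U e -> exists k, V k `<=` U
    & compact (closure (V 0%N))].
Proof.
case: hG => _ [_ _ _ lc /second_countable_enum[b [bo bb]]].
have : forall U : set G, exists V : set G, open U -> U e ->
  [/\ open V, V e, forall x, V x -> V (inv x)
    & forall a b c d, V a -> V b -> V c -> V d -> U (a * b * (c * d))].
  move=> U; have [oU|] := pselect (open U); last by exists set0.
  have [Ue|] := pselect (U e); last by exists set0.
  by have [V VP] := lg_small oU Ue; exists V.
move=> /choice[S SP].
have [W [oW We Wc]] : exists W : set G, [/\ open W, W e & compact (closure W)].
  have := lc e I; move=> [C nC [cC clC]].
  have {nC} : nbhs e C by apply: (@filterS _ (nbhs e) _ [set x | setT x -> C x]) nC => x; exact.
  rewrite nbhsE => -[W [oW We] WC]; exists W; split=> //.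
  apply: (subclosed_compact _ cC); first exact: closed_closure.
  by move/closure_id: clC => ->; exact: closureS.
(* Each basic open set containing [e] is intersected in at its own stage, which makes the sequence a
   base at [e]; starting inside [W] gives relative compactness. *)
pose V := fix V k := if k is k'.+1 then S (V k' `&` (if `[< b k' e >] then b k' else setT)) else S W.
have VP k : open (V k) /\ V k e.
  elim: k => [|k [oVk Vke]]; first by have [] := SP W oW We.
  have [] := SP (V k `&` (if `[< b k e >] then b k else setT)) => //=.
    by apply: openI => //; case: ifP => // _; exact: openT.
  by split=> //; case: ifPn => // /asboolP.
have VS k : [/\ forall x, V k.+1 x -> V k.+1 (inv x) &
    forall a b' c d, V k.+1 a -> V k.+1 b' -> V k.+1 c -> V k.+1 d ->
       (V k `&` (if `[< b k e >] then b k else setT)) (a * b' * (c * d))].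
  have [oVk Vke] := VP k.
  have [] := SP (V k `&` (if `[< b k e >] then b k else setT)) => //=.
    by apply: openI => //; case: ifP => // _; exact: openT.
  by split=> //; case: ifPn => // /asboolP.
exists V; split; split.
- by move=> k; have [] := VP k.
- by move=> k; have [] := VP k.
- by case=> [|k]; [have [] := SP W oW We|have [] := VS k].
- by move=> k a b' c d Va Vb Vc Vd; have [_ /(_ _ _ _ _ Va Vb Vc Vd)[]] := VS k.
- move=> U oU Ue; have [n [ne nU]] := bb U e oU Ue; exists n.+1 => x Vx.
  have [_ /(_ _ _ _ _ (VP n.+1).2 (VP n.+1).2 (VP n.+1).2 Vx)] := VS n.
  by rewrite !lg_mul1 asboolT // => -[_ /nU].
- apply: (subclosed_compact _ Wc); first exact: closed_closure.
  apply: closureS => x Vx; have [_ V0e _ V4] := SP W oW We.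
  by have := V4 _ _ _ _ V0e V0e V0e Vx; rewrite !lg_mul1.
Qed.

(** By telescoping, three factors for one step and one for the tail, [g (k + l)] stays within [V k]
    of [g k]. Relative to [g 0] the sequence therefore remains in a relatively compact set, and a
    cluster point there yields [L]. *)
Lemma lg_cauchy (V : nat -> set G) (g : nat -> G) :
  (forall k, open (V k)) -> (forall k, V k e) -> (forall k x, V k x -> V k (inv x)) ->
  (forall k a b c d, V k.+1 a -> V k.+1 b -> V k.+1 c -> V k.+1 d -> V k (a * b * (c * d))) ->
  compact (closure (V 0%N)) ->
  (forall k, exists a b c, [/\ V k.+1 a, V k.+1 b, V k.+1 c & inv (g k) * g k.+1 = a * b * c]) ->
  exists L, forall k, exists a b, [/\ V k a, V k b & inv L * g k = a * b].
Proof.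
move=> oV Ve Vi V4 cV gS.
have gV k l : V k (inv (g k) * g (k + l)%N).
  elim: l k => [|l IHl] k; first by rewrite addn0 lg_mulV.
  rewrite addnS -addSn -(lg_mulKV (g k.+1) (g (k.+1 + l)%N)) lg_mulA.
  have [a [b [c [Va Vb Vc ->]]]] := gS k.
  by rewrite -(lg_mulA (a * b)); apply: V4 => //; exact: IHl.
pose x l := inv (g 0%N) * g l.
have [|y [_ cy]] := cV (x @ \oo).
  by exists 0%N => // l _; apply: subset_closure; have := gV 0%N l; rewrite add0n.
exists (g 0%N * y) => k.
(* A term of index [l >= k] close to the cluster point links [L] to [g k]. *)
have [z [[l kl <-] Vz]] : [set x l | l in [set l | (k <= l)%N]] `&` [set z | V k (inv y * z)] !=set0.
  apply: cy; first by exists k => // l kl; exists l.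
  by apply: open_nbhs_nbhs; split; [exact: lg_open_translate|rewrite /= lg_mulV].
exists (inv y * x l), (inv (g l) * g k); split=> //.
  by rewrite -(lg_invK (g k)) -lg_invM; apply: Vi; rewrite -(subnKC kl); exact: gV.
by rewrite lg_invM /x -!lg_mulA lg_mulKV.
Qed.

End LcscGroup.

(** * Equivariant limits *)

Section Majority.
Context (R : realType) d (H : measurableType d).
Variable p : {finite_measure set H -> \bar R}.

(** More than half of the mass of [A] lies in [X], written as a sum to avoid division. The strict
    inequality also forces [A] to have positive mass. *)
Definition majority (A X : set H) : Prop :=
  (p A < p (A `&` X) + p (A `&` X))%E.

Lemma majority_sub A X Y : measurable A -> measurable X -> measurable Y ->
  A `&` X `<=` Y -> majority A X -> majority A Y.
Proof.
move=> mA mX mY XY; rewrite /majority => /lt_le_trans; apply.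
have XY' : (p (A `&` X) <= p (A `&` Y))%E.
  by apply: measure_le; [exact: measurableI..|move=> x Ax; split; [case: Ax|exact: XY]].
exact: leeD.
Qed.

(** Two disjoint parts of [A] cannot both exceed half of its finite mass. *)
Lemma majority_meet A X Y : measurable A -> measurable X -> measurable Y ->
  majority A X -> majority A Y -> exists h, [/\ A h, X h & Y h].
Proof.
move=> mA mX mY aX aY; apply: contrapT => /forallNP nex.
have le : (p (A `&` X) + p (A `&` Y) <= p A)%E.
  rewrite -measureU; [| exact: measurableI | exact: measurableI |].
    by apply: measure_le => //; [apply: measurableU; exact: measurableI|move=> h [] []].
  by apply/seteqP; split=> h //= [[Ah Xh] [_ Yh]]; apply: (nex h).
move: aX aY le; rewrite /majority.
rewrite -(fineK (fin_num_measure p _ mA)) -(fineK (fin_num_measure p _ (measurableI _ _ mA mX))).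
rewrite -(fineK (fin_num_measure p _ (measurableI _ _ mA mY))) -!EFinD !lte_fin lee_fin.
by lra.
Qed.

Lemma majority_nonnull A X : measurable A -> measurable X -> majority A X ->
  (p (A `&` X) != 0)%E.
Proof.
move=> mA mX; rewrite /majority; apply: contraPN => /eqP ->.
by rewrite adde0 => /(le_lt_trans (measure_ge0 p A)); rewrite ltxx.
Qed.

Lemma majority_ae A X Y N : measurable A -> measurable X -> measurable Y ->
  measurable N -> p N = 0%E -> (forall h, ~ N h -> X h -> Y h) ->
  majority A X -> majority A Y.
Proof.
move=> mA mX mY mN N0 XY; rewrite /majority => /lt_le_trans; apply.
suff le : (p (A `&` X) <= p (A `&` Y))%E by exact: leeD.
apply: (@le_trans _ _ (p ((A `&` Y) `|` N))).
  apply: measure_le; [exact: measurableI|apply: measurableU => //; exact: measurableI|].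
  move=> h [Ah Xh]; have [Nh|nN] := pselect (N h); first by right.
  by left; split=> //; exact: XY.
apply: le_trans (measureU2 _ _ mN) _; first exact: measurableI.
by rewrite [X in (_ + X)%E]N0 adde0.
Qed.

(** The mass of a section of a measurable set is a measurable function of the base point. *)
Lemma measurable_majority d' (T : measurableType d') (A : set H) (X : T -> set H) :
  measurable A -> measurable [set z : T * H | X z.1 z.2] ->
  measurable [set t | majority A (X t)].
Proof.
move=> mA mX.
have mAX : measurable [set z : T * H | A z.2 /\ X z.1 z.2].
  apply: measurable_conj => //.
  rewrite (_ : [set z | _] = setT `*` A); first exact: measurableX.
  by apply/seteqP; split=> z //= [].
have mf := measurable_fun_xsection p mAX.
have := @measurable_lte _ T R setT measurableT (cst (p A)) _ (measurable_cst _)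
  (emeasurable_funD mf mf).
rewrite setTI; congr (measurable _); apply/seteqP; split=> t /=;
  by rewrite /majority /xsection/=; congr (_ < p _ + p _)%E; apply/seteqP; split=> h /=; rewrite inE.
Qed.

Lemma measurable_pred_section d' (T : measurableType d') (X : T -> set H) t :
  measurable [set z : T * H | X z.1 z.2] -> measurable (X t).
Proof.
move=> /(measurable_xsection t); congr (measurable _).
by apply/seteqP; split=> h; rewrite /xsection/= inE.
Qed.

End Majority.

(** The least witness, or [0] if there is none; being determined by the predicate alone, it is a
    measurable and invariant choice whenever the predicate is. *)
Definition first_nat (P : nat -> Prop) : nat :=
  xget 0%N [set n | P n /\ forall m, (m < n)%N -> ~ P m].

Lemma first_natP (P : nat -> Prop) : (exists n, P n) -> P (first_nat P).
Proof.
move=> [n Pn]; have ex : exists n, `[< P n >] by exists n; apply/asboolP.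
rewrite /first_nat; case: xgetP => [m _ []//|/(_ (ex_minn ex))[]].
case: ex_minnP => m /asboolP Pm mP; split=> // k km Pk.
by have := mP k (asboolT Pk); rewrite leqNgt km.
Qed.

Lemma eq_first_nat (P Q : nat -> Prop) : (forall n, P n <-> Q n) -> first_nat P = first_nat Q.
Proof. by move=> PQ; congr first_nat; apply/funext => n; apply/propext. Qed.

Lemma measurable_first_nat d (T : measurableType d) (P : T -> nat -> Prop) n :
  (forall n, measurable [set t | P t n]) -> measurable [set t | first_nat (P t) = n].
Proof.
move=> mP.
have mfst m : measurable [set t | P t m /\ forall k, (k < m)%N -> ~ P t k].
  apply: measurable_conj => //; apply: measurable_forall => k.
  by apply: measurable_imply; [exact: measurable_const|exact: measurable_not].
have E t m : (P t m /\ forall k, (k < m)%N -> ~ P t k) -> first_nat (P t) = m.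
  move=> [Pm mP']; rewrite /first_nat; case: xgetP => [k _ [Pk kP]|/(_ m)/=]; last by case.
  by case: (ltngtP k m) => // [/mP'|/kP].
(* The second set accounts for the default value [0]. *)
rewrite (_ : [set t | _] = [set t | (P t n /\ forall k, (k < n)%N -> ~ P t k)] `|`
   ([set t | ~ exists m, P t m] `&` [set t : T | n = 0%N])); last first.
  apply/seteqP; split=> t /=.
    move=> <-; have [/first_natP Pt|nex] := pselect (exists m, P t m).
      left; rewrite /first_nat; case: xgetP => // none; exfalso.
      have ex : exists n, `[< P t n >] by eexists; apply/asboolP; exact: Pt.
      apply: (none (ex_minn ex)); case: ex_minnP => m /asboolP Pm mP'; split=> // k km Pk.
      by have := mP' k (asboolT Pk); rewrite leqNgt km.
    right; split=> //; rewrite /first_nat; case: xgetP => // m _ [Pm _].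
    by exfalso; apply: nex; exists m.
  case=> [/E//|[nex ->]]; rewrite /first_nat; case: xgetP => // m _ [Pm _].
  by exfalso; apply: nex; exists m.
apply: measurableU => //; apply: measurableI; last exact: measurable_const.
by apply: measurable_not; exact: measurable_exists.
Qed.

Section EquivariantLimit.
Context (R : realType) (G : ptopologicalType) (mul : G -> G -> G) (e : G) (inv : G -> G).
Hypothesis hG : lcsc_group mul e inv.
Context dT (T : measurableType dT) dH (H : measurableType dH).
Variables (p : {finite_measure set H -> \bar R}) (B : nat -> set H).
Hypothesis p_nz : p setT != 0%E.
Hypothesis mB : forall n, measurable (B n).
Hypothesis B_dense : forall Q, measurable Q -> p Q != 0%E -> exists n, majority p (B n) Q.
Variable u : T * H -> borel G.
Hypothesis mu : measurable_fun setT u.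

Variable V : nat -> set G.
Hypothesis oV : forall k, open (V k).
Hypothesis Ve : forall k, V k e.
Hypothesis Vi : forall k x, V k x -> V k (inv x).
Hypothesis V4 : forall k a b c d, V k.+1 a -> V k.+1 b -> V k.+1 c -> V k.+1 d ->
  V k (mul (mul a b) (mul c d)).
Hypothesis Vbase : forall U : set G, open U -> U e -> exists k, V k `<=` U.
Hypothesis V0c : compact (closure (V 0%N)).

Let VS k x : V k.+1 x -> V k x.
Proof.
by move=> Vx; have := V4 (Ve k.+1) (Ve k.+1) (Ve k.+1) Vx; rewrite !(lg_mul1 hG).
Qed.

Let Vle k l x : (k <= l)%N -> V l x -> V k x.
Proof.
elim: l => [|l IHl]; first by rewrite leqn0 => /eqP ->.
by rewrite leq_eqVlt => /orP[/eqP -> //|kl /VS]; exact: IHl.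
Qed.

Let mdiv := lg_measurable_divl hG.

(** Closeness at scale [k + 1] uses only the quotient of two values of [u], so a left translation of
    [u (t, _)] does not change it. *)
Let close k t (h' h : H) := V k.+1 (mul (inv (u (t, h))) (u (t, h'))).

Let mclose k : measurable [set z : T * H * H | close k z.1.1 z.1.2 z.2].
Proof.
have mf : measurable_fun setT (fun z : T * H * H =>
    ((u (z.1.1, z.2) : borel G), (u z.1 : borel G))).
  apply: measurable_fun_pair; apply: measurableT_comp => //.
  by apply: measurable_fun_pair => //; exact: measurableT_comp.
have := @measurableT_comp _ _ _ _ _ _ _ setT _ mdiv mf measurableT _ (borel_open (oV k.+1)).
rewrite setTI; congr (measurable _).
by apply/seteqP; split=> -[[t h'] h].
Qed.

(* The inner majority is over [A], the outer one over [A']: most of [A'] is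
   [V k.+1]-close to most of [A]. *)
Let cross k t A A' := majority p A' [set h' | majority p A (close k t h')].

Let mcross2 k A : measurable A ->
  measurable [set z : T * H | majority p A (close k z.1 z.2)].
Proof. by move=> mA; apply: (@measurable_majority _ _ _ p _ _ A (fun z : T * H => close k z.1 z.2)). Qed.

Let mcross k A A' : measurable A -> measurable A' -> measurable [set t | cross k t A A'].
Proof.
move=> mA mA'; apply: (@measurable_majority _ _ _ p _ _ A' (fun t h' => majority p A (close k t h'))) => //.
exact: mcross2.
Qed.

Let mclose1 k t h' : measurable (close k t h').
Proof. exact: (@measurable_pred_section _ _ _ _ (fun z : T * H => close k z.1 z.2) (t, h') (mclose k)). Qed.

Let mcross1 k t A : measurable A -> measurable [set h' | majority p A (close k t h')].
Proof.
move=> mA.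
exact: (@measurable_pred_section _ _ _ _ (fun t h' => majority p A (close k t h')) t (mcross2 k mA)).
Qed.

Let mu2 (U : set G) : open U -> measurable [set z : T * H | U (u (z.1, z.2))].
Proof.
move=> oU; have := mu measurableT (borel_open oU); rewrite setTI.
by congr (measurable _); apply/seteqP; split=> -[].
Qed.

Let mu1 t (U : set G) : open U -> measurable [set h | U (u (t, h))].
Proof.
by move=> /mu2; exact: (@measurable_pred_section _ _ _ _ (fun t h => U (u (t, h))) t).
Qed.

(** Countably many small open sets cover [G], so on a non-null part of [E] the function [u (t, _)]
    stays in one of them; density of the family [B] then yields a set mostly contained in that
    part. *)
Let concentrate k t E : measurable E -> p E != 0%E ->
  exists n Q, [/\ measurable Q, Q `<=` E, majority p (B n) Q
                & forall h h', Q h -> Q h' -> close k t h' h].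
Proof.
move=> mE E0.
(* Two points of one left translate of [W] have their quotient in [V k.+1]. *)
have [W [oW We Wi W4]] := lg_small hG (oV k.+1) (Ve k.+1).
case: (hG) => _ [_ _ _ _ /second_countable_enum[b [bo bb]]].
pose Z n := [set h | (forall x y, b n x -> b n y -> V k.+1 (mul (inv x) y)) /\ b n (u (t, h))].
have mZ n : measurable (Z n).
  by apply: measurable_conj; [exact: measurable_const|exact: mu1].
have [n En] : exists n, p (E `&` Z n) != 0%E.
  apply: contrapT => /forallNP nE; move/eqP: E0; apply.
  apply/eqP; rewrite eq_le measure_ge0 andbT.
  apply: (@le_trans _ _ (p (\bigcup_n (E `&` Z n)))).
    apply: measure_le => //; first by apply: bigcup_measurable => n _; exact: measurableI.
    move=> h Eh.
    have [||n [nu nW]] := bb [set x | W (mul (inv (u (t, h))) x)] (u (t, h)).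
    - exact: (lg_open_translate hG).
    - by rewrite /= (lg_mulV hG).
    exists n => //; split=> //; split=> // x y /nW/= Wx /nW/= Wy.
    have := W4 _ _ _ _ (Wi _ Wx) Wy We We.
    rewrite (lg_invM hG) (lg_invK hG) -!(lg_mulA hG) (lg_mulKV hG).
    by rewrite (lg_mul1 hG) (lg_mul1r hG).
  apply: le_trans (generalized_Boole_inequality _ _ _) _.
  - by move=> n; exact: measurableI.
  - by apply: bigcup_measurable => n _; exact: measurableI.
  by rewrite eseries0// => n _ _; apply/eqP; have /negP := nE n; rewrite negbK.
have [m mQ] := B_dense (measurableI _ _ mE (mZ n)) En.
exists m, (E `&` Z n); split=> //; first exact: measurableI.
by move=> h h' [_ [bV bh]] [_ [_ bh']]; apply: bV.
Qed.

(** The next set must agree with the current one at the present scale and be concentrated at the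
    finer scale. Both conditions are left invariant. *)
Let nxt k t m n := cross k t (B m) (B n) /\ cross k.+1 t (B n) (B n).

Let idx t := fix idx k :=
  if k is k'.+1 then first_nat (nxt k' t (idx k')) else first_nat (fun n => cross 0 t (B n) (B n)).

Let good k t := cross k t (B (idx t k)) (B (idx t k)).

Let concentrated_good k t n Q : measurable Q -> majority p (B n) Q ->
  (forall h h', Q h -> Q h' -> close k t h' h) -> cross k t (B n) (B n).
Proof.
move=> mQ BQ Qc; apply: (majority_sub _ _ _ _ BQ) => //; first exact: mcross1.
move=> h' [_ Qh']; apply: majority_sub BQ; [exact: mB|exact: mQ|exact: mclose1|].
by move=> h [_ Qh]; exact: Qc.
Qed.

(** Concentration is applied within the points of the current set that are close to most of it; this
    part is non-null since it is a majority. *)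
Let idx_next k t : good k t -> nxt k t (idx t k) (idx t k.+1).
Proof.
move=> gd; apply: first_natP.
have [||n [Q [mQ QE BQ Qc]]] := @concentrate k.+1 t
  (B (idx t k) `&` [set h' | majority p (B (idx t k)) (close k t h')]).
- by apply: measurableI => //; exact: mcross1.
- by apply: majority_nonnull gd => //; exact: mcross1.
exists n; split; last exact: concentrated_good BQ Qc.
by apply: majority_sub BQ; [exact: mB|exact: mQ|exact: mcross1|move=> h [_ /QE[]]].
Qed.

Let idx_good k t : good k t.
Proof.
elim: k => [|k gd]; last by have [] := idx_next gd.
have [n [Q [mQ _ BQ Qc]]] := @concentrate 0 t setT measurableT p_nz.
by apply: (@first_natP (fun n => cross 0 t (B n) (B n))); exists n; exact: concentrated_good BQ Qc.
Qed.

(** Convergence in measure of [u (t, _)] to [g] along the chosen sets, with more than half as the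
    only quantitative demand. *)
Let limit_of t (g : G) := forall U : set G, open U -> U e ->
  exists K, forall k, (K <= k)%N -> majority p (B (idx t k)) [set h | U (mul (inv g) (u (t, h)))].

Let mtr t g (U : set G) : open U -> measurable [set h | U (mul g (u (t, h)))].
Proof. by move=> oU; apply: (@mu1 t [set x | U (mul g x)]); exact: (lg_open_translate hG). Qed.

Let limit_ex t : exists g, limit_of t g.
Proof.
have : forall k, exists g, majority p (B (idx t k)) [set h | V k.+1 (mul (inv g) (u (t, h)))].
  move=> k; have gd := idx_good k t.
  have [h' [_ mj _]] := majority_meet (mB _) (mcross1 k t (mB _)) (mcross1 k t (mB _)) gd gd.
  exists (u (t, h')); apply: majority_sub mj; [exact: mB|exact: mclose1|exact: mtr|].
  by move=> h [_ /Vi]; rewrite /= (lg_invM hG) (lg_invK hG).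
move=> /choice[g gP].
have [k|L LP] := lg_cauchy hG oV Ve Vi V4 V0c (g := g).
  have [cr _] := idx_next (idx_good k t).
  (* [g k] and [g k.+1] are compared through two points: [h'] has its value near [g k.+1] and is
     close to most of the earlier set, and [h] in that set is close to [h'] with its value near
     [g k]. This gives the three factors. *)
  have [h' [_ mj Vh']] := majority_meet (mB _) (mcross1 k t (mB _)) (mtr _ _ (oV _)) cr (gP k.+1).
  have [h [_ hh' Vh]] := majority_meet (mB _) (mclose1 k t h') (mtr _ _ (oV _)) mj (gP k).
  exists (mul (inv (g k)) (u (t, h))), (mul (inv (u (t, h))) (u (t, h'))),
    (mul (inv (u (t, h'))) (g k.+1)); split=> //.
    by rewrite -(lg_invK hG (g k.+1)) -(lg_invM hG); apply/Vi/VS.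
  by rewrite -!(lg_mulA hG) !(lg_mulKV hG).
exists L => U oU Ue; have [m mU] := Vbase oU Ue.
(* The estimate of [lg_cauchy] at [k + 1] has two factors in [V k.+1]; with the deviation of [u]
   from [g k.+1] their product lies in [V k], hence in [V m]. *)
exists m.+1 => -[//|k] mk.
apply: majority_sub (gP k.+1); [exact: mB|exact: mtr|exact: mtr|].
move=> h [_ /= Vh]; apply/mU/(@Vle _ k) => //.
have [a [b [Va Vb ab]]] := LP k.+1.
rewrite -(lg_mulKV hG (g k.+1) (u (t, h))) (lg_mulA hG) ab -(lg_mul1r hG (mul (inv _) _)).
by apply: V4 => //; exact: VS.
Qed.

(** Disjoint neighbourhoods of two limits would each receive the values on a majority of one common
    set. *)
Let limit_uniq t g g' : limit_of t g -> limit_of t g' -> g = g'.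
Proof.
case: (hG) => _ [_ _ + _ _]; rewrite open_hausdorff => hd lg lg'.
apply/eqP; apply: contrapT => /negP /hd[[A A'] /= [/set_mem Ag /set_mem A'g'] [oA oA' /eqP AA']].
have [||K KP] := lg [set x | A (mul g x)]; first exact: (lg_open_translate hG).
  by rewrite /= (lg_mul1r hG).
have [||K' KP'] := lg' [set x | A' (mul g' x)]; first exact: (lg_open_translate hG).
  by rewrite /= (lg_mul1r hG).
have oT x (W : set G) : open W -> open [set y | W (mul x y)] by exact: (lg_open_translate hG).
have [h [_ /= Ah A'h]] := majority_meet (mB _) (mtr t (inv g) (oT g _ oA)) (mtr t (inv g') (oT g' _ oA'))
  (KP _ (leq_maxl K K')) (KP' _ (leq_maxr K K')).
rewrite !(lg_mulKV hG) in Ah A'h.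
by have : (A `&` A') (u (t, h)) by []; rewrite AA'.
Qed.

Let lim t : borel G := xget e (limit_of t).

Let limP t : limit_of t (lim t). Proof. exact: xgetPex (limit_ex t). Qed.

Let measurable_idx k n : measurable [set t | idx t k = n].
Proof.
elim: k n => [|k IHk] n /=.
  by apply: (@measurable_first_nat _ _ (fun t n => cross 0 t (B n) (B n))) => m; exact: mcross.
apply: (@measurable_first_nat _ _ (fun t n => nxt k t (idx t k) n)) => m.
rewrite (_ : [set t | _] = [set t | exists l, idx t k = l /\ nxt k t l m]).
  by apply: measurable_exists => l; apply: measurable_conj => //; apply: measurable_conj; exact: mcross.
by apply/seteqP; split=> t /=; [exists (idx t k)|move=> [l [->]]].
Qed.

Let measurable_lim : measurable_fun setT lim.
Proof.
case: (hG) => _ [_ _ _ _ /second_countable_enum[b [bo bb]]].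
apply: measurable_fun_borel => U oU; rewrite setTI.
(* The limit lies in [U] exactly when, for some basic [b j] that remains in [U] after right
   multiplication by some [V m], the values eventually lie in [b j] on a majority. The quantifiers
   are countable. *)
rewrite (_ : lim @^-1` U = [set t | exists jm : nat * nat,
  (forall x v, b jm.1 x -> V jm.2 v -> U (mul x v)) /\
  exists K, forall k, (K <= k)%N -> exists n, idx t k = n /\
    majority p (B n) [set h | b jm.1 (u (t, h))]]).
  apply: measurable_exists => -[j m]; apply: measurable_conj; first exact: measurable_const.
  apply: measurable_exists => K; apply: measurable_forall => k.
  apply: measurable_imply; first exact: measurable_const.
  apply: measurable_exists => n; apply: measurable_conj => //.
  apply: (@measurable_majority _ _ _ p _ _ (B n) (fun t h => b j (u (t, h)))) => //.
  exact: mu2.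
apply/seteqP; split=> t /=.
  move=> Ut.
  have [||k kU] := @Vbase [set x | U (mul (lim t) x)]; first exact: (lg_open_translate hG).
    by rewrite /= (lg_mul1r hG).
  have [||j [jt jV]] := bb [set x | V k.+1 (mul (inv (lim t)) x)] (lim t).
  - exact: (lg_open_translate hG).
  - by rewrite /= (lg_mulV hG).
  exists (j, k.+1); split=> /=.
    move=> x v /jV/= Vx Vv.
    have := kU _ (V4 Vx Vv (Ve _) (Ve _)).
    by rewrite /= (lg_mul1 hG) (lg_mul1r hG) -(lg_mulA hG) (lg_mulKV hG).
  have [||K KP] := @limP t [set x | b j (mul (lim t) x)]; first exact: (lg_open_translate hG).
    by rewrite /= (lg_mul1r hG).
  exists K => k' Kk'; exists (idx t k'); split=> //.
  apply: majority_sub (KP _ Kk'); [exact: mB|apply: mtr; exact: (lg_open_translate hG)|exact: mu1|].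
  by move=> h [_ /=]; rewrite (lg_mulKV hG).
move=> [[j m] /= [jm [K KP]]].
have [K' KP'] := limP t (oV m) (Ve m).
have [n [nt mj]] := KP _ (leq_maxl K K').
have := KP' _ (leq_maxr K K'); rewrite nt => mj'.
have [h [_ /= bh Vh]] := majority_meet (mB _) (mu1 t (bo j)) (mtr t _ (oV m)) mj mj'.
have := jm _ _ bh (Vi Vh).
by rewrite (lg_invM hG) (lg_invK hG) (lg_mulKV hG).
Qed.

(** Closeness ignores the translation and majorities ignore the null set, so [t] and [t'] select the
    same indices; along the same sets the limit is translated by [g]. *)
Let lim_equivariant t t' g N : measurable N -> p N = 0%E ->
  (forall h, ~ N h -> u (t', h) = mul g (u (t, h))) -> lim t' = mul g (lim t).
Proof.
move=> mN N0 tt'.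
have cl k h h' : ~ N h -> ~ N h' -> close k t' h' h <-> close k t h' h.
  by move=> Nh Nh'; rewrite /close !tt'// (lg_invM hG) -(lg_mulA hG) (lg_mulK hG).
have cr1 k h' A : measurable A -> ~ N h' ->
    majority p A (close k t' h') <-> majority p A (close k t h').
  move=> mA Nh'; split; apply: (majority_ae mA _ _ mN N0); try exact: mclose1.
    by move=> h Nh; move/(cl k h h' Nh Nh').
  by move=> h Nh; move/(cl k h h' Nh Nh').
have cr k A A' : measurable A -> measurable A' -> cross k t' A A' <-> cross k t A A'.
  move=> mA mA'; split; apply: (majority_ae mA' _ _ mN N0); try exact: mcross1.
    by move=> h Nh; move/(cr1 k h A mA Nh).
  by move=> h Nh; move/(cr1 k h A mA Nh).
have ix k : idx t' k = idx t k.
  elim: k => [|k IHk] /=; first by apply: eq_first_nat => n; exact: cr.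
  rewrite IHk; apply: eq_first_nat => n; rewrite /nxt.
  have [c1 c1'] := cr k (B (idx t k)) (B n) (mB _) (mB _).
  have [c2 c2'] := cr k.+1 (B n) (B n) (mB _) (mB _).
  by split=> -[a b]; split; [exact: c1|exact: c2|exact: c1'|exact: c2'].
apply: (limit_uniq (t := t')); first exact: limP.
move=> U oU Ue; have [K KP] := limP t oU Ue; exists K => k Kk; rewrite ix.
apply: majority_ae (KP _ Kk); [exact: mB|exact: mtr|exact: mtr|exact: mN|exact: N0|].
by move=> h Nh /=; rewrite tt'// (lg_invM hG) -(lg_mulA hG) (lg_mulK hG).
Qed.

Lemma equivariant_limit_of_base : exists L : T -> borel G, measurable_fun setT L /\
  forall t t' g N, measurable N -> p N = 0%E ->
    (forall h, ~ N h -> u (t', h) = mul g (u (t, h))) -> L t' = mul g (L t).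
Proof. by exists lim; split; [exact: measurable_lim|exact: lim_equivariant]. Qed.

End EquivariantLimit.

Lemma equivariant_limit (R : realType) (G : ptopologicalType) (mul : G -> G -> G)
    (e : G) (inv : G -> G) dT (T : measurableType dT) dH (H : measurableType dH)
    (p : {finite_measure set H -> \bar R}) (B : nat -> set H) (u : T * H -> borel G) :
  lcsc_group mul e inv -> p setT != 0%E -> (forall n, measurable (B n)) ->
  (forall Q, measurable Q -> p Q != 0%E -> exists n, majority p (B n) Q) ->
  measurable_fun setT u ->
  exists L : T -> borel G, measurable_fun setT L /\
    forall t t' g N, measurable N -> p N = 0%E ->
      (forall h, ~ N h -> u (t', h) = mul g (u (t, h))) -> L t' = mul g (L t).
Proof.
move=> hG p0 mB Bd mu; have [V [[oV Ve Vi] [V4 Vb V0]]] := lg_nbhs_base hG.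
exact (equivariant_limit_of_base hG p0 mB Bd mu oV Ve Vi V4 Vb V0).
Qed.

(** * Null sets in products and Haar measure *)

Lemma null_xsection_ae (R : realType) d1 d2 (T1 : measurableType d1) (T2 : measurableType d2)
    (m1 : {sigma_finite_measure set T1 -> \bar R})
    (m2 : {sigma_finite_measure set T2 -> \bar R}) (P : T1 -> set T2) :
  measurable [set z : T1 * T2 | P z.1 z.2] ->
  (forall y, m1 [set x | P x y] = 0%E) ->
  measurable [set x | m2 (P x) = 0%E] /\ m1 (~` [set x | m2 (P x) = 0%E]) = 0%E.
Proof.
move=> mP P0; pose A := [set z : T1 * T2 | P z.1 z.2].
have PE x : xsection A x = P x.
  by apply/seteqP; split=> y; rewrite /xsection/= inE.
pose f : T1 -> \bar R := fun x => m2 (P x).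
have mf : measurable_fun setT f.
  have := measurable_fun_xsection m2 mP; congr (measurable_fun _ _).
  by apply/funext => x /=; rewrite -/A PE.
have mE : measurable [set x | m2 (P x) = 0%E].
  by have := mf measurableT _ (emeasurable_set1 0%E); rewrite setTI.
split=> //.
have A0 : (m1 \x m2)%E A = 0%E.
  (* Uniqueness of the product measure exchanges the order of integration, so null sections in one
     direction make the whole set null. *)
  rewrite (@product_measure_unique _ _ _ _ _ m1 m2 (m1 \x^ m2)%E)//=.
    rewrite /product_measure2 integral0_eq// => y _ /=.
    rewrite -[RHS](P0 y); congr (m1 _).
    by apply/seteqP; split=> x; rewrite /ysection/= inE.
  by move=> X Y mX mY; rewrite product_measure2E.
have : (\int[m1]_x `|m2 (P x)| = 0)%E.
  rewrite -[RHS]A0 /product_measure1; apply: eq_integral => x _ /=.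
  by rewrite gee0_abs// -/A PE.
move/(ae_eq_integral_abs _ measurableT mf) => ae0.
apply/negligibleP; first exact: measurableC.
by apply: negligibleS ae0 => x /= nx0 h; apply: nx0; exact: h.
Qed.

Section Haar.
Context (R : realType) (G : ptopologicalType) (mul : G -> G -> G) (e : G) (inv : G -> G).
Hypothesis hG : lcsc_group mul e inv.
Variable lam : {measure set (borel G) -> \bar R}.
Hypothesis hlam : haar mul lam.

Lemma compact_borel (K : set G) : compact K -> measurable (K : set (borel G)).
Proof.
case: hG => _ [_ _ hd _ _] /(compact_closed hd) cK.
by rewrite -(setCK K); apply: measurableC; apply: borel_open; exact: closed_openC.
Qed.

(** By local compactness the basic open sets of finite measure cover [G]; the others are replaced by
    the empty set. *)
Lemma haar_sigma_finite : sigma_finite setT lam.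
Proof.
case: (hG) => _ [_ _ hd lc /second_countable_enum[b [bo bb]]].
case: hlam => _ lamK _ _ _.
exists (fun n => [set x | (lam (b n) < +oo)%E /\ b n x]); last first.
  move=> n; split.
    by apply: measurable_conj; [exact: measurable_const|exact: (borel_open (bo n))].
  have [fin|inf] := pselect (lam (b n) < +oo)%E.
    by rewrite (_ : [set x | _] = b n)//; apply/seteqP; split=> x /=; [case|split].
  by rewrite (_ : [set x | _] = set0) ?measure0//; apply/seteqP; split=> x //= [].
apply/esym/seteqP; split=> // x _.
have [C nC [cC _]] := lc x I.
have : nbhs x C by apply: (@filterS _ (nbhs x) _ [set x | setT x -> C x]) nC => y; exact.
rewrite nbhsE => -[W [oW Wx] WC]; have [n [nx nW]] := bb W x oW Wx.
exists n => //; split=> //; apply: le_lt_trans (lamK _ cC).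
by apply: measure_le; [exact: (borel_open (bo n))|exact: compact_borel|exact: subset_trans WC].
Qed.

(** [p] is Haar measure restricted to a compact set of positive measure, which inner regularity
    provides, and [B] enumerates the finite unions of basic open sets. *)
Lemma haar_finite_dense : exists (p : {finite_measure set (borel G) -> \bar R})
    (B : nat -> set (borel G)),
  [/\ p setT != 0%E, forall n, measurable (B n),
      forall Q, measurable Q -> p Q != 0%E -> exists n, majority p (B n) Q
    & forall N, measurable N -> lam N = 0%E -> p N = 0%E].
Proof.
case: (hG) => _ [_ _ hd lc /second_countable_enum[b [bo bb]]].
case: hlam => _ lamK lamU lamI lam0.
have [K cK K0] : exists2 K : set G, compact K & lam K != 0%E.
  apply: contrapT => /forall2NP nK; move/eqP: lam0; apply.
  apply/eqP; rewrite eq_le measure_ge0 andbT lamI; last exact: openT.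
  apply: ge_ereal_sup => _ [K [cK _] <-]; have [//|/negP] := nK K.
  by rewrite negbK => /eqP ->.
have mK : measurable (K : set (borel G)) by exact: compact_borel.
pose p : {finite_measure set (borel G) -> \bar R} := mfrestr mK (lamK _ cK).
have pE Q : p Q = lam (Q `&` K) by [].
pose Bs (l : seq nat) : set (borel G) := [set x | exists i : nat, i \in l /\ b i x].
pose B n := Bs (odflt [::] (unpickle n)).
have BK l : B (pickle l) = Bs l by rewrite /B pickleK.
have mBs l : measurable (Bs l).
  by apply: measurable_exists => i; apply: measurable_conj; [exact: measurable_const|exact: (borel_open (bo i))].
exists p, B; split=> [|n||].
- by rewrite pE setTI.
- exact: mBs.
- move=> Q mQ; rewrite pE => Q0; set Q' := Q `&` K in Q0.
  have mQ' : measurable Q' by exact: measurableI.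
  have Qfin : lam Q' \is a fin_num.
    rewrite ge0_fin_numE//; apply: le_lt_trans (lamK _ cK).
    by apply: measure_le => //; exact: subIsetr.
  pose q := fine (lam Q').
  have qE : lam Q' = q%:E by rewrite /q fineK.
  have q0 : 0 < q by rewrite -lte_fin -qE lt0e Q0 measure_ge0.
  (* An open [U] of measure below [3/2 q] and a finite union of basic sets in [U] capturing more
     than [3/4 q] of [Q'] make a majority, since twice [3/4] is [3/2]. *)
  have [U [oU QU] Uq] : exists2 U : set G, open U /\ Q' `<=` U & (lam U < (3 / 2 * q)%:E)%E.
    have : (ereal_inf [set lam U | U in [set U : set G | open U /\ Q' `<=` U]] < (3 / 2 * q)%:E)%E.
      by rewrite -lamU// qE lte_fin; lra.
    by move=> /ereal_inf_lt[_ [U UP <-] Uq]; exists U.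
  pose s n := [seq i <- iota 0 n | `[< b i `<=` U >]].
  pose F n := Bs (s n) `&` Q'.
  have FP n x : F n x <-> (exists i, [/\ (i < n)%N, b i `<=` U & b i x]) /\ Q' x.
    rewrite /F /Bs /=; split=> -[].
      move=> [i []]; rewrite mem_filter mem_iota add0n => /andP[/asboolP iU /andP[_ lt]] bi Qx.
      by split=> //; exists i.
    move=> [i [lt iU bi]] Qx; split=> //; exists i; split=> //.
    by rewrite mem_filter mem_iota add0n lt asboolT.
  have cupF : \bigcup_n F n = Q'.
    apply/seteqP; split=> x; first by move=> [n _ /FP[]].
    move=> Qx; have [i [bi iU]] := bb U x oU (QU _ Qx).
    by exists i.+1 => //; apply/FP; split=> //; exists i.
  have mF n : measurable (F n) by exact: measurableI.
  have : lam \o F @ \oo --> lam (\bigcup_n F n).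
    apply: nondecreasing_cvg_mu => //; first by rewrite cupF.
    move=> m n mn; apply/subsetPset => x /FP[[i [lt iU bi]] Qx].
    by apply/FP; split=> //; exists i; split=> //; exact: leq_trans mn.
  rewrite cupF qE => /(_ [set z | (3 / 4 * q)%:E < z]%E)/=; case.
    by apply: open_nbhs_nbhs; split; [exact: open_ereal_gt_ereal|rewrite /= lte_fin; lra].
  move=> n _ /(_ n (leqnn n))/= nF; exists (pickle (s n)).
  rewrite /majority BK !pE -setIA -/Q' -/(F n).
  apply: (@lt_trans _ _ (3 / 2 * q)%:E).
    apply: le_lt_trans Uq; apply: measure_le; [exact: measurableI|exact: borel_open|].
    move=> x [[i []] + + _].
    by rewrite mem_filter => /andP[/asboolP iU _] /iU.
  rewrite (_ : 3 / 2 * q = 3 / 4 * q + 3 / 4 * q); last by lra.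
  by rewrite EFinD; exact: lteD.
- move=> N mN N0; rewrite pE; apply: subset_measure0 N0 => //; exact: measurableI.
Qed.

End Haar.

Section SigmaFiniteMeasure.
Context (R : realType) d (T : measurableType d) (lam : {measure set T -> \bar R}).
Variable sf : sigma_finite setT lam.

(** A copy of [lam] that carries the proof of sigma-finiteness, so that it can serve as a
    sigma-finite measure. *)
Definition sfmeasure of sigma_finite setT lam : set T -> \bar R := lam.

HB.instance Definition _ := Measure.copy (sfmeasure sf) lam.
HB.instance Definition _ := Measure_isSigmaFinite.Build _ _ _ (sfmeasure sf) sf.

End SigmaFiniteMeasure.

(** * Couplings *)

Lemma measurable_fun_ifset d d' (T : measurableType d) (U : measurableType d')
    (D : set T) (f g : T -> U) : measurable D ->
  measurable_fun D f -> measurable_fun setT g ->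
  measurable_fun setT (fun t => if t \in D then f t else g t).
Proof.
move=> mD mf mg; apply: measurable_fun_if => //.
- apply: (measurable_fun_bool true); rewrite setTI.
  rewrite (_ : _ @^-1` _ = D)//; by apply/seteqP; split=> t /=; [exact: set_mem|exact: mem_set].
- rewrite setTI (_ : _ @^-1` _ = D)//; by apply/seteqP; split=> t /=; [exact: set_mem|exact: mem_set].
- exact: measurable_funTS.
Qed.

Section CouplingCoordinates.
Context (R : realType) (G : ptopologicalType) (mulG : G -> G -> G) (eG : G) (invG : G -> G).
Hypothesis hG : lcsc_group mulG eG invG.
Variable lamG : {measure set (borel G) -> \bar R}.
Hypothesis hlamG : haar mulG lamG.
Context dO dY (Om : measurableType dO) (Y : measurableType dY).
Variables (eta : {measure set Om -> \bar R}) (nu : {finite_measure set Y -> \bar R}).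
Variable act : G -> Om -> Om.
Variable i : borel G * Y -> Om.

(** [pi] and [psi] are the two coordinates of the inverse of [i], made total. The invariant domain
    in [G * Y] is the product of [setT] and [Y0], because invariance under translation leaves no
    condition on the first coordinate. *)
Record coupling_coords (O : set Om) (Y0 : set Y) (pi : Om -> borel G) (psi : Om -> Y) : Prop :=
 CouplingCoords {
  cc_mO : measurable O;
  cc_mY0 : measurable Y0;
  cc_O0 : eta (~` O) = 0%E;
  cc_Y00 : nu (~` Y0) = 0%E;
  cc_mpi : measurable_fun setT pi;
  cc_mpsi : measurable_fun setT psi;
  cc_mi : measurable_fun setT i;
  cc_O_act : forall g t, O t -> O (act g t);
  cc_O_i : forall g y, Y0 y -> O (i (g, y));
  cc_Y0_psi : forall t, O t -> Y0 (psi t);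
  cc_i : forall t, O t -> i (pi t, psi t) = t;
  cc_pi_i : forall g y, Y0 y -> pi (i (g, y)) = g;
  cc_psi_i : forall g y, Y0 y -> psi (i (g, y)) = y;
  cc_i_act : forall g0 g y, Y0 y -> i (mulG g0 g, y) = act g0 (i (g, y));
  cc_meas : forall S, measurable S -> S `<=` O ->
    (lamG \x nu)%E ((setT `*` Y0) `&` i @^-1` S) = eta S }.

(** The total Haar mass is nonzero, and even if it is infinite its product with [0] is [0]. *)
Lemma product_setT_null (Z : set Y) : measurable Z ->
  (lamG \x nu)%E (setT `*` Z) = 0%E <-> nu Z = 0%E.
Proof.
move=> mZ; case: hlamG => _ _ _ _ lam0.
rewrite product_measure1E//; split=> [/eqP|Z0]; last by rewrite [X in (_ * X)%E]Z0 mule0.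
by rewrite mule_eq0 (negbTE lam0) /= => /eqP.
Qed.

(** An invariant subset of [G * Y] is determined by its section [Ys] at [eG]. The parameter [Q]
    allows the fibres to be restricted in advance to a conull set, such as the atoms. *)
Lemma coupling_coords_ex (Q : set Y) : measurable Q -> nu (~` Q) = 0%E ->
  meas_space_iso (fun (g : G) (p : borel G * Y) => (mulG g p.1, p.2)) act
    (lamG \x nu)%E eta i ->
  exists O Y0 pi psi, coupling_coords O Y0 pi psi /\ Y0 `<=` Q.
Proof.
move=> mQ Q0 [mi [S1 [S2 [f [[mS1 mS2 S10 S20] [[S1a S2a] [[iS fS fi iF] [_ mf ia im]]]]]]]].
pose Ys := [set y | S1 (eG, y)].
have mYs : measurable Ys.
  have := @measurable_pair1 _ _ (borel G) Y eG measurableT _ mS1.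
  by rewrite setTI.
have S1E g y : S1 (g, y) <-> Ys y.
  by have := S1a g (eG, y); rewrite /= (lg_mul1r hG).
have Ys0 : nu (~` Ys) = 0%E.
  apply/product_setT_null; first exact: measurableC.
  rewrite -[RHS]S10; congr (_ _); apply/seteqP; split=> -[g y] /=.
    by move=> [_ nY]; apply: contra_not nY => /(S1E g).
  by move=> nS; split=> //; apply: contra_not nS => /(S1E g).
pose Y0 := Ys `&` Q; have mY0 : measurable Y0 by exact: measurableI.
pose O := S2 `&` [set t | Q (f t).2].
have mO : measurable O.
  have := mf mS2 _ (@measurable_snd _ _ (borel G) Y measurableT _ mQ).
  by congr (measurable _); apply/seteqP; split=> t /=; [move=> [? [_ ?]]|move=> [? ?]]; split.
pose pi t : borel G := (if t \in S2 then f t else (eG, point)).1.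
pose psi t : Y := (if t \in S2 then f t else (eG, point)).2.
have mif := measurable_fun_ifset mS2 mf (measurable_cst ((eG, point) : borel G * Y)).
have piE t : S2 t -> (pi t, psi t) = f t.
  by move=> St; rewrite /pi /psi mem_set//; case: (f t).
have YsF t : S2 t -> Ys (f t).2.
  by move=> /fS; case: (f t) => g y /S1E.
exists O, Y0, pi, psi; split; last exact: subIsetr.
have O_i g y : Y0 y -> O (i (g, y)).
  move=> [Yy Qy]; have Sgy : S1 (g, y) by apply/S1E.
  by split=> /=; [exact: iS|rewrite fi].
have fS1 t : S2 t -> f t = (pi t, psi t) by move=> /piE.
split=> //.
- apply: (@subset_measure0 _ _ _ _ _ (~` S2 `|` (S2 `\` O))).
  + exact: measurableC.
  + by apply: measurableU; [exact: measurableC|exact: measurableD].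
  + by move=> t nO; have [St|] := pselect (S2 t); [right|left].
  apply: null_set_setU => //; [exact: measurableC|exact: measurableD|].
  have mD : measurable (S2 `\` O) by exact: measurableD.
  rewrite -im//.
  apply: (@subset_measure0 _ _ _ _ _ (setT `*` ~` Q)).
  + by apply: measurableI => //; rewrite -[X in measurable X]setTI; exact: mi.
  + by apply: measurableX => //; exact: measurableC.
  + move=> [g y] [Sgy [Sy nO]]; split=> //= Qy; apply: nO; split=> //=.
    by rewrite fi.
  + by apply/product_setT_null => //; exact: measurableC.
- apply: (@subset_measure0 _ _ _ _ _ (~` Ys `|` ~` Q)).
  + exact: measurableC.
  + by apply: measurableU; exact: measurableC.
  + by rewrite -setCI.
  by apply: null_set_setU => //; exact: measurableC.
- exact: measurableT_comp mif.
- exact: measurableT_comp mif.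
- move=> g t [St Qt]; split=> /=; first exact/S2a.
  rewrite -{1}(iF _ St) -ia ?fi//; last exact: fS.
  by apply/S1a; exact: fS.
- by move=> t [St Qt]; split; [have := YsF _ St|move: Qt => /=]; rewrite fS1.
- by move=> t [St _]; rewrite piE// iF.
- by move=> g y [Yy _]; have Sgy : S1 (g, y) by [apply/S1E]; rewrite /pi mem_set ?fi//; exact: iS.
- by move=> g y [Yy _]; have Sgy : S1 (g, y) by [apply/S1E]; rewrite /psi mem_set ?fi//; exact: iS.
- by move=> g0 g y [Yy _]; rewrite -ia//; apply/S1E.
- move=> S mS SO; rewrite -im//; last by move=> t /SO[].
  congr (_ _); apply/seteqP; split=> -[g y] /= [].
    by move=> [_ [Yy _]] Si; split=> //; apply/S1E.
  move=> Sgy Si; split=> //; split=> //; split; first exact/(S1E g).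
  by have [_ /=] := SO _ Si; rewrite fi.
Qed.

End CouplingCoordinates.

Lemma lg_measurable_inv (G : ptopologicalType) (mul : G -> G -> G) (e : G) (inv : G -> G) :
  lcsc_group mul e inv -> measurable_fun setT (inv : borel G -> borel G).
Proof.
case=> _ [_ /continuousP ci _ _ _]; apply: measurable_fun_borel => U oU.
by rewrite setTI; apply: borel_open; exact: ci.
Qed.

(** * One side of a coupling *)

Section CouplingSide.
Context (R : realType) (G H : ptopologicalType).
Context (mulG : G -> G -> G) (eG : G) (invG : G -> G).
Context (mulH : H -> H -> H) (eH : H) (invH : H -> H).
Hypotheses (hG : lcsc_group mulG eG invG) (hH : lcsc_group mulH eH invH).
Variables (lamG : {measure set (borel G) -> \bar R}) (lamH : {measure set (borel H) -> \bar R}).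
Hypotheses (hlamG : haar mulG lamG) (hlamH : haar mulH lamH).
Hypothesis lamH_right : forall (h : H) (A : set (borel H)), measurable A ->
  lamH [set x | A (mulH x h)] = lamH A.
Context dO dY (Om : measurableType dO) (Y : measurableType dY).
Hypotheses (sOm : standard_borel R Om) (sY : standard_borel R Y).
Variables (eta : {measure set Om -> \bar R}) (nu : {finite_measure set Y -> \bar R}).
Variable act : G -> H -> Om -> Om.
Hypothesis act_meas : measurable_fun setT
  (fun p : borel G * borel H * Om => act p.1.1 p.1.2 p.2).
Hypothesis act1 : forall t, act eG eH t = t.
Hypothesis actM : forall g1 g2 h1 h2 t,
  act (mulG g1 g2) (mulH h1 h2) t = act g1 h1 (act g2 h2 t).
Hypothesis act_pres : forall g h (A : set Om), measurable A ->
  eta (act g h @^-1` A) = eta A.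
Variable i : borel G * Y -> Om.

Let actG g1 g2 t : act (mulG g1 g2) eH t = act g1 eH (act g2 eH t).
Proof. by rewrite -actM (lg_mul1 hH). Qed.

Let actGK g t : act (invG g) eH (act g eH t) = t.
Proof. by rewrite -actG (lg_mulV hG) act1. Qed.

Let actGVK g t : act g eH (act (invG g) eH t) = t.
Proof. by rewrite -actG (lg_mulVr hG) act1. Qed.

Let actC g h t : act eG h (act g eH t) = act g eH (act eG h t).
Proof. by rewrite -!actM (lg_mul1 hG) (lg_mul1r hG) (lg_mul1 hH) (lg_mul1r hH). Qed.

Let act_split g h t : act g h t = act g eH (act eG h t).
Proof. by rewrite -actM (lg_mul1r hG) (lg_mul1 hH). Qed.

Let measurable_act d (T : measurableType d) (f : T -> borel G) (k : T -> borel H) (w : T -> Om) :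
  measurable_fun setT f -> measurable_fun setT k -> measurable_fun setT w ->
  measurable_fun setT (fun t => act (f t) (k t) (w t)).
Proof.
move=> mf mk mw.
exact: (measurableT_comp act_meas (measurable_fun_pair (measurable_fun_pair mf mk) mw)).
Qed.

Section Coordinates.
Variables (O : set Om) (Y0 : set Y) (pi : Om -> borel G) (psi : Om -> Y).
Hypothesis C : coupling_coords mulG lamG eta nu (fun g t => act g eH t) i O Y0 pi psi.

Let O_act g t : O (act g eH t) <-> O t.
Proof.
split; last exact: (cc_O_act C).
by move=> /(cc_O_act C (invG g)); rewrite actGK.
Qed.

Let pi_psi_act g t : O t -> pi (act g eH t) = mulG g (pi t) /\ psi (act g eH t) = psi t.
Proof.
move=> Ot; have Yt := cc_Y0_psi C Ot.
rewrite -{1 3}(cc_i C Ot) -(cc_i_act C)//.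
by rewrite (cc_pi_i C)// (cc_psi_i C).
Qed.

(** An exhaustion of [G] by sets of finite Haar measure is pulled back along [pi]; finiteness of
    [nu] bounds the pieces, and piece [0] is the null complement of [O]. *)
Lemma coupling_sigma_finite : sigma_finite setT eta.
Proof.
have [F FT Ffin] := haar_sigma_finite hG hlamG.
exists (fun n => if n is m.+1 then O `&` pi @^-1` F m else ~` O).
  apply/esym/seteqP; split=> // t _; have [Ot|nO] := pselect (O t); last by exists 0%N.
  have : setT (pi t) by []; rewrite FT => -[m _ Fm].
  by exists m.+1.
case=> [|m]; first by split; [exact: measurableC (cc_mO C)|rewrite (cc_O0 C)].
have mD : measurable (O `&` pi @^-1` F m).
  apply: measurableI; first exact: cc_mO C.
  by rewrite -[X in measurable X]setTI; apply: (cc_mpi C) => //; have [] := Ffin m.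
split=> //; rewrite -(cc_meas C)//.
rewrite (_ : _ `&` _ = F m `*` Y0); last first.
  apply/seteqP; split=> -[g y] /=; first by move=> [[_ Yy] [_ /=]]; rewrite (cc_pi_i C).
  by move=> [Fg Yy]; split=> //; split=> /=; [exact: (cc_O_i C)|rewrite (cc_pi_i C)].
have [mF Ff] := Ffin m.
rewrite product_measure1E//; last exact: cc_mY0 C.
apply: lte_mul_pinfty => //.
  by rewrite ge0_fin_numE.
by rewrite -ge0_fin_numE//; apply: fin_num_measure; exact: cc_mY0 C.
Qed.

Definition ae_orbit : set Om := [set t | lamH [set h | ~ O (act eG h t)] = 0%E].

Let m_ae : measurable [set z : Om * borel H | ~ O (act eG z.2 z.1)].
Proof.
have m : measurable_fun setT (fun z : Om * borel H => act eG z.2 z.1).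
  by apply: measurable_act.
by apply: measurable_not; have := m measurableT _ (cc_mO C); rewrite setTI.
Qed.

Let m_ae1 t : measurable [set h : borel H | ~ O (act eG h t)].
Proof. exact: (@measurable_pred_section _ _ _ _ (fun t (h : borel H) => ~ O (act eG h t)) t m_ae). Qed.

(** For fixed [h] the points that [h] moves out of [O] form a null set, as the action preserves
    [eta]; Fubini exchanges the quantifiers. *)
Lemma ae_orbit_conull : measurable ae_orbit /\ eta (~` ae_orbit) = 0%E.
Proof.
have sfe := coupling_sigma_finite; have sfH := haar_sigma_finite hH hlamH.
apply: (@null_xsection_ae R _ _ Om (borel H) (sfmeasure sfe) (sfmeasure sfH)
  (fun t (h : borel H) => ~ O (act eG h t))); first exact: m_ae.
move=> h; rewrite /sfmeasure.
have := act_pres eG h (measurableC (cc_mO C)); rewrite (cc_O0 C).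
exact.
Qed.

(** The [G] part disappears because the actions commute and [O] is [G]-invariant; the [H] part
    translates the exceptional set on the right, which is where unimodularity enters. *)
Lemma ae_orbit_act g h t : ae_orbit t -> ae_orbit (act g h t).
Proof.
rewrite /ae_orbit/= => Et; rewrite -[RHS]Et -[RHS](lamH_right h (m_ae1 t)).
have E h' : O (act eG h' (act g h t)) <-> O (act eG (mulH h' h) t).
  by rewrite (act_split g h) actC O_act -actM (lg_mul1 hG).
by congr (lamH _); apply/seteqP; split=> h' /=; apply: contra_not => /E.
Qed.

(** The limit construction is applied to [pi] along the [H]-orbit; equivariance of [pi] holds for
    all [h] outside the null exceptional set. *)
Lemma ae_orbit_limit : exists L : Om -> borel G, measurable_fun setT L /\
  forall g t, ae_orbit t -> L (act g eH t) = mulG g (L t).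
Proof.
have [p [B [p0 mB Bd ac]]] := haar_finite_dense hH hlamH.
have mu : measurable_fun setT (fun z : Om * borel H => pi (act eG z.2 z.1)).
  by apply: (measurableT_comp (cc_mpi C)); apply: measurable_act.
have [L [mL LP]] := equivariant_limit hG p0 mB Bd mu.
exists L; split=> // g t Et.
apply: (LP _ _ _ [set h : borel H | ~ O (act eG h t)]) => //.
  exact: ac.
move=> h /contrapT Oh /=; rewrite actC.
by have [] := pi_psi_act g Oh.
Qed.

Let atoms := [set y | nu [set y] != 0%E].

Lemma ae_orbit_sub_atomic : Y0 `<=` atoms -> ae_orbit `<=` O.
Proof.
move=> Yat t Et; apply: contrapT => nOt.
case: (hlamH) => _ _ _ _ lH0; case: (hlamG) => _ _ _ _ lG0.
have [h Oh] : exists h, O (act eG h t).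
  apply: contrapT => /forallNP nO; move/eqP: lH0; apply; rewrite -[RHS]Et.
  by congr (lamH _); apply/seteqP; split=> // h _; exact: nO.
set s := act eG h t in Oh.
have [dist [c [r Bs]]] := standard_borel_basis sY.
have m1 := measurable_dist1 Bs.
(* [Z] is the [G]-orbit of [s], of measure [lamG setT] times the mass of an atom. Moved back by [h]
   it becomes the orbit of [t], which misses [O], so it is also null. *)
pose Z := O `&` psi @^-1` [set psi s].
have mZ : measurable Z.
  apply: measurableI; first exact: cc_mO C.
  by rewrite -[X in measurable X]setTI; apply: (cc_mpsi C).
have ZE : eta Z = (lamG setT * nu [set psi s])%E.
  rewrite -(cc_meas C)//; last exact: subIsetl.
  rewrite (_ : _ `&` _ = setT `*` [set psi s]); first by rewrite product_measure1E.
  apply/seteqP; split=> -[g y] /=.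
    by move=> [[_ Yy] [_ /=]]; rewrite (cc_psi_i C).
  move=> [_ ->]; have Ys := cc_Y0_psi C Oh; split=> //; split.
    exact: (cc_O_i C).
  by rewrite /= (cc_psi_i C).
have : eta Z = 0%E.
  apply: (@subset_measure0 _ _ _ _ _ (act eG (invH h) @^-1` (~` O))) => //.
  - rewrite -[X in measurable X]setTI; apply: measurable_act => //.
    exact: measurableC (cc_mO C).
  - move=> s' [Os' /= ps'].
    have -> : s' = act (mulG (pi s') (invG (pi s))) eH s.
      rewrite -{2}(cc_i C Oh) -(cc_i_act C); last exact: (cc_Y0_psi C).
      by rewrite -(lg_mulA hG) (lg_mulV hG) (lg_mul1r hG) -ps' (cc_i C).
    rewrite /preimage/= actC O_act /s -actM (lg_mul1 hG) (lg_mulV hH) act1.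
    exact: nOt.
  - by have := act_pres eG (invH h) (measurableC (cc_mO C)); rewrite (cc_O0 C); exact.
rewrite ZE => /eqP; rewrite mule_eq0 (negbTE lG0) /=.
by apply/negP; apply: Yat; exact: (cc_Y0_psi C).
Qed.

(** * Absorption of the exceptional null set *)

Section Absorption.
Variables (F : set Om) (L : Om -> borel G).
Hypotheses (mF : measurable F) (F0 : eta (~` F) = 0%E).
Hypothesis F_act : forall g t, F t -> F (act g eH t).
Hypothesis mL : measurable_fun setT L.
Hypothesis L_act : forall g t, F t -> L (act g eH t) = mulG g (L t).
Variables (theta : Om -> Y) (thetai : Y -> Om) (S : set Y).
Hypotheses (mS : measurable S) (S0 : nu S = 0%E).
Hypotheses (mtheta : measurable_fun setT theta) (mthetai : measurable_fun setT thetai).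
(** Required only at the exceptional points of [F]. In the purely atomic case there are none and [S]
    is empty, so both cases fit the same construction. *)
Hypothesis theta_absorb : forall t, F t -> ~ (O t /\ ~ S (psi t)) ->
  S (theta t) /\ thetai (theta t) = t.
Hypothesis thetaiK : forall y, S y -> theta (thetai y) = y.

(** The points that keep their old coordinates. The fibres over the null set [S] are vacated to make
    room, and their points join the exceptional ones. *)
Let good := [set t | O t /\ ~ S (psi t)].

Let mgood : measurable good.
Proof.
apply: measurable_conj; first exact: cc_mO C.
by apply: measurable_not; have := cc_mpsi C measurableT mS; rewrite setTI.
Qed.

Let good_act g t : good (act g eH t) <-> good t.
Proof.
rewrite /good/= O_act; split=> -[Ot]; by rewrite (pi_psi_act g Ot).2.
Qed.

(** A fundamental domain for [G] on the exceptional part of [F]: equivariance of [L] puts exactly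
    one point of each orbit in it. *)
Let W := [set t | [/\ F t, ~ good t & L t = eG]].

Let mW : measurable W.
Proof.
rewrite (_ : W = F `&` (~` good `&` L @^-1` [set eG])); last first.
  by apply/seteqP; split=> t /= => [[? ? ?]|[? [? ?]]].
apply: measurableI => //; apply: measurableI; first exact: measurableC.
rewrite -[X in measurable X]setTI; apply: mL => //.
case: (hG) => _ [_ _ hd _ _].
have -> : [set eG] = ~` (~` [set eG] : set (borel G)) by rewrite setCK.
apply: measurableC; apply: borel_open; apply: closed_openC.
exact: accessible_closed_set1 (hausdorff_accessible hd) _.
Qed.

(** [Y1] indexes the old fibres that are kept, tested at [eG] alone since [F] is invariant; [Y2] is
    the copy of [W] inside [S]. *)
Let Y1 := [set y | [/\ Y0 y, ~ S y & F (i (eG, y))]].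
Let Y2 := [set y | S y /\ W (thetai y)].
Let Y' := Y1 `|` Y2.

Let miy (D : set Om) : measurable D -> measurable [set y | D (i (eG, y))].
Proof.
move=> mD; have m : measurable_fun setT (fun y => i (eG, y)).
  by apply: (measurableT_comp (cc_mi C)); exact: measurable_pair1.
by have := m measurableT _ mD; rewrite setTI.
Qed.

Let mY1 : measurable Y1.
Proof.
rewrite (_ : Y1 = Y0 `&` (~` S `&` [set y | F (i (eG, y))])); last first.
  by apply/seteqP; split=> t /= => [[? ? ?]|[? [? ?]]].
apply: measurableI; first exact: cc_mY0 C.
by apply: measurableI; [exact: measurableC|exact: miy].
Qed.

Let mY2 : measurable Y2.
Proof. by apply: measurable_conj => //; have := mthetai measurableT mW; rewrite setTI. Qed.

Let mY' : measurable Y'. Proof. exact: measurableU. Qed.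

Let iE g y : Y0 y -> i (g, y) = act g eH (i (eG, y)).
Proof. by move=> Yy; rewrite -(cc_i_act C)// (lg_mul1r hG). Qed.

Let i' (z : borel G * Y) : Om := if z.2 \in S then act z.1 eH (thetai z.2) else i z.

Let i'inv (t : Om) : borel G * Y :=
  if t \in good then (pi t, psi t) else (L t, theta (act (invG (L t)) eH t)).

Let i'1 g y : Y1 y -> i' (g, y) = i (g, y).
Proof. by move=> [_ nS _]; rewrite /i' memNset. Qed.

Let i'2 g y : S y -> i' (g, y) = act g eH (thetai y).
Proof. by move=> Sy; rewrite /i' mem_set. Qed.

Let i'inv1 t : good t -> i'inv t = (pi t, psi t).
Proof. by move=> gt; rewrite /i'inv mem_set. Qed.

Let i'inv2 t : ~ good t -> i'inv t = (L t, theta (act (invG (L t)) eH t)).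
Proof. by move=> gt; rewrite /i'inv memNset. Qed.

Let Y'_null : nu (~` Y') = 0%E.
Proof.
pose Z := [set y | Y0 y /\ ~ F (i (eG, y))].
have mZ : measurable Z.
  by apply: measurable_conj; [exact: cc_mY0 C|apply: measurable_not; exact: miy].
have Z0 : nu Z = 0%E.
  apply/(product_setT_null hlamG nu mZ).
  rewrite (_ : _ `*` _ = (setT `*` Y0) `&` i @^-1` (O `\` F)).
    rewrite (cc_meas C); [|apply: measurableD => //; exact: cc_mO C|exact: subDsetl].
    apply: subset_measure0 F0; [apply: measurableD => //; exact: cc_mO C|exact: measurableC|].
    by move=> t [].
  apply/seteqP; split=> -[g y] /=.
    move=> [_ [Yy nF]]; split=> //; split; first exact: (cc_O_i C).
    apply: contra_not nF; rewrite iE// => /(F_act (invG g)).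
    by rewrite actGK.
  move=> [[_ Yy] [_ nF]]; split=> //; split=> //; apply: contra_not nF => /(F_act g).
  by rewrite -iE.
apply: (@subset_measure0 _ _ _ _ _ (~` Y0 `|` S `|` Z)).
- exact: measurableC.
- by apply: measurableU => //; apply: measurableU => //; exact: measurableC (cc_mY0 C).
- move=> y nY'; have [Sy|nS] := pselect (S y); first by left; right.
  have [Yy|nY] := pselect (Y0 y); last by left; left.
  by right; split=> // Fy; apply: nY'; left.
- have mY0c : measurable (~` Y0) by exact: measurableC (cc_mY0 C).
  apply: null_set_setU => //; first exact: measurableU.
  by apply: null_set_setU => //; exact: (cc_Y00 C).
Qed.

Let W_i' g y : Y2 y -> [/\ F (i' (g, y)), ~ good (i' (g, y)) & L (i' (g, y)) = g].
Proof.
move=> [Sy [Fy ngy Ly]]; rewrite i'2//; split; first exact: F_act.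
  by rewrite good_act.
by rewrite L_act// Ly (lg_mul1r hG).
Qed.

Let i'_F z : (setT `*` Y') z -> F (i' z).
Proof.
case: z => g y [_ /= []].
  by move=> Y1y; rewrite i'1//; case: Y1y => Yy _ Fy; rewrite iE//; exact: F_act.
by move=> /(W_i' g)[].
Qed.

Let good_i g y : Y1 y -> good (i (g, y)).
Proof.
by move=> [Yy nS _]; split; [exact: (cc_O_i C)|rewrite (cc_psi_i C)].
Qed.

Let i'K z : (setT `*` Y') z -> i'inv (i' z) = z.
Proof.
case: z => g y [_ /= []] Yy.
  rewrite i'1// i'inv1; last exact: good_i.
  by case: Yy => Yy _ _; rewrite (cc_pi_i C)// (cc_psi_i C).
have [Fi ng Li] := W_i' g Yy.
rewrite i'inv2// Li; case: Yy => Sy _; rewrite i'2// actGK.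
by rewrite thetaiK.
Qed.

Let base t : F t -> ~ good t -> W (act (invG (L t)) eH t).
Proof.
move=> Ft ng; split; first exact: F_act.
  by rewrite good_act.
by rewrite L_act// (lg_mulV hG).
Qed.

Let i'inv_Y' t : F t -> (setT `*` Y') (i'inv t).
Proof.
move=> Ft; split=> //; have [gt|ng] := pselect (good t).
  rewrite i'inv1//; left; have [Ot nS] := gt; split=> //=; first exact: (cc_Y0_psi C).
  have := F_act (invG (pi t)) Ft.
  by rewrite -{2}(cc_i C Ot) -(cc_i_act C) ?(lg_mulV hG)//; exact: (cc_Y0_psi C).
rewrite i'inv2//=; right; have Wt := base Ft ng; have [Fw ngw Lw] := Wt.
by have [Sw wK] := theta_absorb Fw ngw; split=> //; rewrite wK.
Qed.

Let i'invK t : F t -> i' (i'inv t) = t.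
Proof.
move=> Ft; have [gt|ng] := pselect (good t).
  rewrite i'inv1// /i' memNset/=; last by case: gt.
  by rewrite (cc_i C)//; case: gt.
rewrite i'inv2//; have [Fw ngw Lw] := base Ft ng.
by have [Sw wK] := theta_absorb Fw ngw; rewrite i'2// wK actGVK.
Qed.

Let mi' : measurable_fun setT i'.
Proof.
have mSG : measurable ([set z | S z.2] : set (borel G * Y)).
  rewrite (_ : [set z | _] = setT `*` S); first exact: measurableX.
  by apply/seteqP; split=> z //= [].
have E z : (z \in [set z : borel G * Y | S z.2]) = (z.2 \in S).
  by apply/idP/idP => /set_mem ?; exact: mem_set.
have -> : i' = fun z => if z \in [set z : borel G * Y | S z.2]
    then act z.1 eH (thetai z.2) else i z by apply/funext => z; rewrite E.
apply: measurable_fun_ifset; [exact: mSG| |exact: (cc_mi C)].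
by apply: measurable_funTS; apply: measurable_act => //; exact: measurableT_comp.
Qed.

Let mi'inv : measurable_fun setT i'inv.
Proof.
apply: measurable_fun_ifset => //.
  by apply: measurable_funTS; apply: measurable_fun_pair; [exact: cc_mpi C|exact: cc_mpsi C].
apply: measurable_fun_pair => //; apply: (measurableT_comp mtheta).
apply: measurable_act => //.
exact: (measurableT_comp (lg_measurable_inv hG)).
Qed.

Let i'_measure D : measurable D -> D `<=` F ->
  (lamG \x nu)%E ((setT `*` Y') `&` i' @^-1` D) = eta D.
Proof.
move=> mD DF.
have mm (Z : set Y) : measurable Z -> measurable ((setT `*` Z) `&` i' @^-1` D).
  move=> mZ; apply: measurableI; first exact: measurableX.
  by rewrite -[X in measurable X]setTI; exact: mi'.
have mDg : measurable (D `&` good) by exact: measurableI.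
have mDn : measurable (D `\` good) by exact: measurableD.
(* All the mass sits on the kept fibres. The exceptional part is null in [Om] by [e2], and the new
   fibres are null in [G * Y] by [e3], lying over [S]. *)
have e1 : (lamG \x nu)%E ((setT `*` Y1) `&` i' @^-1` D) = eta (D `&` good).
  rewrite -(cc_meas C)//; last by move=> t [_ []].
  congr (_ _); apply/seteqP; split=> -[g y] /= [].
    move=> [_ Yy]; rewrite i'1// => Di; split; last by split=> //; exact: good_i.
    by case: Yy.
  move=> [_ Yy] [Di [Oi]]; rewrite (cc_psi_i C)// => nS.
  suff Y1y : Y1 y by split=> //; rewrite i'1.
  split=> //; have := F_act (invG g) (DF _ Di); rewrite -(cc_i_act C)//.
  by rewrite (lg_mulV hG).
have e2 : eta (D `\` good) = 0%E.
  pose Z := O `&` psi @^-1` S.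
  have mZ : measurable Z.
    apply: measurableI; first exact: cc_mO C.
    by rewrite -[X in measurable X]setTI; exact: (cc_mpsi C).
  apply: (@subset_measure0 _ _ _ _ _ (~` O `|` Z)) => //.
  - by apply: measurableU => //; exact: measurableC (cc_mO C).
  - move=> t [_ ng]; have [Ot|] := pselect (O t); last by left.
    by right; split=> //; apply: contrapT => nS; apply: ng.
  apply: null_set_setU => //; [exact: measurableC (cc_mO C)|exact: (cc_O0 C)|].
  rewrite -(cc_meas C)//; last exact: subIsetl.
  apply: (@subset_measure0 _ _ _ _ _ (setT `*` S)).
  - apply: measurableI; first by apply: measurableX => //; exact: cc_mY0 C.
    by rewrite -[X in measurable X]setTI; exact: (cc_mi C).
  - exact: measurableX.
  - by move=> [g y] [[_ /= Yy] [_ /=]]; rewrite (cc_psi_i C).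
  - exact/(product_setT_null hlamG nu mS).
have e3 : (lamG \x nu)%E ((setT `*` Y2) `&` i' @^-1` D) = 0%E.
  apply: (@subset_measure0 _ _ _ _ _ (setT `*` S)).
  - exact: mm.
  - exact: measurableX.
  - by move=> [g y] [[_ [Sy _]] _].
  - exact/(product_setT_null hlamG nu mS).
have -> : eta D = eta (D `&` good).
  by rewrite -[RHS]add0e -[X in _ = (X + _)%E]e2; exact: measureDI.
rewrite -e1 (_ : _ `&` _ = ((setT `*` Y1) `&` i' @^-1` D) `|` ((setT `*` Y2) `&` i' @^-1` D)).
  apply: measureU0; [exact: mm|exact: mm|exact: e3].
apply/seteqP; split=> -[g y] /=; first by move=> [[_ [Yy|Yy]] Di]; [left|right].
by case=> -[[_ Yy] Di]; split=> //; split=> //; [left|right].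
Qed.

Lemma coupling_iso_absorb : exists Y'' : set Y,
  [/\ measurable Y'', nu (~` Y'') = 0%E &
  exists (k : borel G * Y -> Om) (kinv : Om -> borel G * Y),
       [/\ (forall p, (setT `*` Y'') p -> F (k p)),
           (forall t, F t -> (setT `*` Y'') (kinv t)),
           (forall p, (setT `*` Y'') p -> kinv (k p) = p) &
           (forall t, F t -> k (kinv t) = t)] /\
       [/\ measurable_fun (setT `*` Y'') k & measurable_fun F kinv] /\
       (forall D : set Om, measurable D -> D `<=` F ->
          (lamG \x nu)%E ((setT `*` Y'') `&` k @^-1` D) = eta D) /\
       (forall (g0 g : G) (y : Y), Y'' y ->
          k (mulG g0 g, y) = act g0 eH (k (g, y)))].
Proof.
exists Y'; split=> //; exists i', i'inv; do !split => //.
- exact: measurable_funTS.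
- exact: measurable_funTS.
move=> g0 g y [Yy|[Sy _]]; last by rewrite !i'2// actG.
by rewrite !i'1//; case: Yy => Yy _ _; rewrite (cc_i_act C).
Qed.

End Absorption.
End Coordinates.

(** The domain [F] is left open: any invariant conull measurable part of [E] will do, so that the
    two sides can later be given the same one. *)
Lemma coupling_side :
  meas_space_iso (fun (g : G) (p : borel G * Y) => (mulG g p.1, p.2))
    (fun (g : G) t => act g eH t) (lamG \x nu)%E eta i ->
  exists E : set Om,
  [/\ measurable E, eta (~` E) = 0%E & forall g h t, E t -> E (act g h t)] /\
  forall F : set Om, measurable F -> F `<=` E -> eta (~` F) = 0%E ->
  (forall g h t, F t -> F (act g h t)) ->
  exists Y'' : set Y,
  [/\ measurable Y'', nu (~` Y'') = 0%E &
  exists (k : borel G * Y -> Om) (kinv : Om -> borel G * Y),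
       [/\ (forall p, (setT `*` Y'') p -> F (k p)),
           (forall t, F t -> (setT `*` Y'') (kinv t)),
           (forall p, (setT `*` Y'') p -> kinv (k p) = p) &
           (forall t, F t -> k (kinv t) = t)] /\
       [/\ measurable_fun (setT `*` Y'') k & measurable_fun F kinv] /\
       (forall D : set Om, measurable D -> D `<=` F ->
          (lamG \x nu)%E ((setT `*` Y'') `&` k @^-1` D) = eta D) /\
       (forall (g0 g : G) (y : Y), Y'' y ->
          k (mulG g0 g, y) = act g0 eH (k (g, y)))].
Proof.
move=> hi; pose atoms := [set y | nu [set y] != 0%E].
have [dist [c [r Bs]]] := standard_borel_basis sY; have m1 := measurable_dist1 Bs.
have matoms : measurable atoms.
  by apply: countable_measurable; [exact: m1|exact: countable_atoms].
(* If [nu] is purely atomic, the fibres are restricted to atoms and nothing is exceptional;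
   otherwise the null Cantor set of [Y] receives the exceptional points. *)
have [A0|A1] := eqVneq (nu (~` atoms)) 0%E.
  have [Og [Y0 [pi [psi [C YQ]]]]] := coupling_coords_ex hG hlamG matoms A0 hi.
  exists (ae_orbit Og); have [mE E0] := ae_orbit_conull C.
  split; first by split=> //; exact: (ae_orbit_act C).
  move=> F mF FE F0 Fa; have [L [mL LP]] := ae_orbit_limit C.
  have EO := ae_orbit_sub_atomic C YQ.
  apply: (@coupling_iso_absorb _ _ _ _ C F L mF F0 _ mL _ (cst point) (cst point) set0) => //.
  - by move=> g t; exact: Fa.
  - by move=> g t /FE; exact: LP.
  - by move=> t Ft []; split=> //; apply/EO/FE.
have T0 : nu (~` setT) = 0%E by rewrite setCT measure0.
have [Og [Y0 [pi [psi [C _]]]]] := coupling_coords_ex hG hlamG measurableT T0 hi.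
exists (ae_orbit Og); have [mE E0] := ae_orbit_conull C.
split; first by split=> //; exact: (ae_orbit_act C).
move=> F mF FE F0 Fa; have [L [mL LP]] := ae_orbit_limit C.
have [theta [thetai [S [[mS S0 mth mthi] [thS thK thiK]]]]] :=
  standard_borel_null_embedding sOm sY A1.
apply: (@coupling_iso_absorb _ _ _ _ C F L mF F0 _ mL _ theta thetai S) => //.
- by move=> g t; exact: Fa.
- by move=> g t /FE; exact: LP.
Qed.

End CouplingSide.

Theorem mainTheorem6 (R : realType)
  (G H : ptopologicalType)
  (mulG : G -> G -> G) (eG : G) (invG : G -> G)
  (mulH : H -> H -> H) (eH : H) (invH : H -> H)
  (hG : lcsc_group mulG eG invG) (hH : lcsc_group mulH eH invH)
  (uG : unimodular R mulG) (uH : unimodular R mulH)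
  (lamG : {measure set (borel G) -> \bar R}) (hlamG : haar mulG lamG)
  (lamH : {measure set (borel H) -> \bar R}) (hlamH : haar mulH lamH)
  (dO dX dY : measure_display)
  (Om : measurableType dO) (X : measurableType dX) (Y : measurableType dY)
  (sOm : standard_borel R Om) (sX : standard_borel R X) (sY : standard_borel R Y)
  (eta : {measure set Om -> \bar R}) (eta_nz : (eta setT != 0)%E)
  (mu : {finite_measure set X -> \bar R}) (nu : {finite_measure set Y -> \bar R})
  (act : G -> H -> Om -> Om)
  (act_meas : measurable_fun setT
                (fun p : borel G * borel H * Om => act p.1.1 p.1.2 p.2))
  (act1 : forall t, act eG eH t = t)
  (actM : forall g1 g2 h1 h2 t,
            act (mulG g1 g2) (mulH h1 h2) t = act g1 h1 (act g2 h2 t))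
  (act_pres : forall g h (A : set Om), measurable A ->
                eta (act g h @^-1` A) = eta A)
  (i : borel G * Y -> Om)
  (hi : meas_space_iso (fun (g : G) (p : borel G * Y) => (mulG g p.1, p.2))
                       (fun (g : G) t => act g eH t) (lamG \x nu)%E eta i)
  (j : borel H * X -> Om)
  (hj : meas_space_iso (fun (h : H) (p : borel H * X) => (mulH h p.1, p.2))
                       (fun (h : H) t => act eG h t) (lamH \x mu)%E eta j) :
  exists (Om' : set Om) (X' : set X) (Y' : set Y)
         (b : G -> H -> Om -> Om),
    [/\ measurable Om', measurable X' & measurable Y'] /\
    [/\ eta (~` Om') = 0%E, mu (~` X') = 0%E & nu (~` Y') = 0%E] /\
    (* measure preserving Borel action of G x H on Om' *)
    [/\ (forall g h t, Om' t -> Om' (b g h t)),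
        (forall t, Om' t -> b eG eH t = t),
        (forall g1 g2 h1 h2 t, Om' t ->
           b (mulG g1 g2) (mulH h1 h2) t = b g1 h1 (b g2 h2 t)),
        measurable_fun (setT `*` Om')
          (fun p : borel G * borel H * Om => b p.1.1 p.1.2 p.2)
      & (forall g h (S : set Om), measurable S -> S `<=` Om' ->
           eta (Om' `&` b g h @^-1` S) = eta S)] /\
    (* (i) *)
    (forall g h, {ae eta, forall t, Om' t -> act g h t = b g h t}) /\
    (* (ii) *)
    (exists (i' : borel G * Y -> Om) (i'inv : Om -> borel G * Y),
       [/\ (forall p, (setT `*` Y') p -> Om' (i' p)),
           (forall t, Om' t -> (setT `*` Y') (i'inv t)),
           (forall p, (setT `*` Y') p -> i'inv (i' p) = p) &
           (forall t, Om' t -> i' (i'inv t) = t)] /\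
       [/\ measurable_fun (setT `*` Y') i' & measurable_fun Om' i'inv] /\
       (forall S : set Om, measurable S -> S `<=` Om' ->
          (lamG \x nu)%E ((setT `*` Y') `&` i' @^-1` S) = eta S) /\
       (forall (g0 g : G) (y : Y), Y' y ->
          i' (mulG g0 g, y) = b g0 eH (i' (g, y)))) /\
    (* (iii) *)
    (exists (j' : borel H * X -> Om) (j'inv : Om -> borel H * X),
       [/\ (forall p, (setT `*` X') p -> Om' (j' p)),
           (forall t, Om' t -> (setT `*` X') (j'inv t)),
           (forall p, (setT `*` X') p -> j'inv (j' p) = p) &
           (forall t, Om' t -> j' (j'inv t) = t)] /\
       [/\ measurable_fun (setT `*` X') j' & measurable_fun Om' j'inv] /\
       (forall S : set Om, measurable S -> S `<=` Om' ->
          (lamH \x mu)%E ((setT `*` X') `&` j' @^-1` S) = eta S) /\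
       (forall (h0 h : H) (x : X), X' x ->
          j' (mulH h0 h, x) = b eG h0 (j' (h, x)))).
Proof.
(* The [G] side needs right invariance on [H], and conversely; each is given by unimodularity of the
   other group. *)
have [EG [[mEG EG0 EGa] sideG]] := coupling_side hG hH hlamG hlamH (uH lamH hlamH)
  sOm sY act_meas act1 actM act_pres hi.
have act_meas' : measurable_fun setT
    (fun p : borel H * borel G * Om => act p.1.2 p.1.1 p.2).
  apply: (measurableT_comp act_meas (g := fun p : borel H * borel G * Om => (p.1.2, p.1.1, p.2))).
  apply: measurable_fun_pair => //; apply: measurable_fun_pair; exact: measurableT_comp.
have [EH [[mEH EH0 EHa] sideH]] := coupling_side hH hG hlamH hlamG (uG lamG hlamG)
  sOm sX (act := fun h g t => act g h t) act_meas' act1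
  (fun h1 h2 g1 g2 t => actM g1 g2 h1 h2 t) (fun h g => act_pres g h) hj.
(* Both sides accept this common domain, which is invariant under the whole product. *)
pose F := EG `&` EH.
have mF : measurable F by exact: measurableI.
have F0 : eta (~` F) = 0%E.
  by rewrite setCI; apply: null_set_setU => //; exact: measurableC.
have Fa g h t : F t -> F (act g h t).
  by move=> [GFt HFt]; split; [exact: EGa|exact: EHa].
have [Y' [mY' Y'0 [i' [i'inv i'P]]]] := sideG F mF (@subIsetl _ _ _) F0 Fa.
have [X' [mX' X'0 [j' [j'inv j'P]]]] := sideH F mF (@subIsetr _ _ _) F0 (fun h g t => Fa g h t).
(* The action itself is unchanged, so (i) holds at every point. *)
exists F, X', Y', act; split; first by [].
split; first by [].
split.
  split=> //; first exact: measurable_funTS.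
  move=> g h S mS SF; rewrite -[RHS](act_pres g h S mS).
  have mpre : measurable (act g h @^-1` S).
    rewrite -[X in measurable X]setTI.
    apply: (measurableT_comp act_meas (g := fun t : Om => ((g : borel G, h : borel H), t))) => //.
    by apply: measurable_fun_pair.
  (* The part of the preimage outside [F] is null, so restricting to [F] keeps the measure. *)
  rewrite [RHS](measureDI eta mpre mF) setIC.
  rewrite [X in (X + _)%E](_ : _ = 0%E) ?add0e//.
  apply: subset_measure0 F0; [exact: measurableD|exact: measurableC|by move=> t []].
split; first by move=> g h; exact: aeW.
by split; [exists i', i'inv|exists j', j'inv].
Qed.
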